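(* Let $d\mu=e^{-V}dx$ be a probability measure on $\mathbb{R}^n$ such that there exists $\alpha>0$ with $$\Delta V(x)\le\alpha n\quad\text{for every }x\in\mathbb{R}^n .$$ Let $\gamma$ be the standard Gaussian measure on $\mathbb{R}^n$, let $f:=\frac{d\mu}{d\gamma}$, and let $(F_t)_{t\ge0}$ be the flow $$\partial_tF_t(x)=-\nabla\log \mathrm P_tf(F_t(x))\ \text{ for } t>0,\ x\in\mathbb{R}^n,\qquad F_0(x)=x\ \text{ for } x\in\mathbb{R}^n,$$ which is assumed to have a unique smooth solution. Suppose that this flow converges to a differentiable limit $F:=\lim_{t\to\infty}F_t$, and that $\lim_{t\to\infty}\det\nabla F_t=\det\nabla F$. Then the Kim–Milman heat flow map $F$ between $\mu$ and $\gamma$ satisfies $$\|\det\nabla F\|_{L^\infty(dx)}\le\alpha^{\frac n2}.$$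
   Context: $(\mathrm P_t)_{t\ge0}$ is the Ornstein–Uhlenbeck semigroup $\mathrm P_tf(x):=\int_{\mathbb{R}^n}f(e^{-t}x+\sqrt{1-e^{-2t}}\,y)\,d\gamma(y)$, for $t\ge0$, $x\in\mathbb{R}^n$, $f\in L^1(\gamma)$. The maps $F_t:\mathbb{R}^n\to\mathbb{R}^n$ are diffeomorphisms transporting $\mu$ to $(\mathrm P_tf)\,d\gamma$. The limit $F$ is by definition the Kim–Milman heat flow map from $\mu$ to $\gamma$. Limits as $t\to\infty$ are pointwise in $x$. *)

(* Defs.v *)
From HB Require Import structures.
From mathcomp Require Import all_boot all_order all_algebra.
From mathcomp Require Import all_classical all_reals all_analysis.
From mathcomp Require Import measurable_realfun.

Set Implicit Arguments.
Unset Strict Implicit.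
Unset Printing Implicit Defensive.
Import Order.TTheory GRing.Theory Num.Theory.
Import numFieldNormedType.Exports.

Local Open Scope classical_set_scope.
Local Open Scope ring_scope.

(* The Borel sigma-algebra of R^n, as the product sigma-algebra. *)
Definition rV_display : measure_display. Proof. exact. Qed.

Section measurable_rV.
Context {R : realType} {n : nat}.

Let coord (i : 'I_n) (x : 'rV[R]_n) : measurableTypeR R := x ord0 i.

Let rV_set0 : g_sigma_preimage coord set0.
Proof. exact: sigma_algebra0. Qed.

Let rV_setC A : g_sigma_preimage coord A -> g_sigma_preimage coord (~` A).
Proof. exact: sigma_algebraC. Qed.

Let rV_bigcup (F : _^nat) : (forall i, g_sigma_preimage coord (F i)) ->
  g_sigma_preimage coord (\bigcup_i (F i)).
Proof. exact: sigma_algebra_bigcup. Qed.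

HB.instance Definition _ := @isMeasurable.Build rV_display
  'rV[R]_n (g_sigma_preimage coord) rV_set0 rV_setC rV_bigcup.

End measurable_rV.

Lemma measurable_coord (R : realType) n (i : 'I_n) :
  measurable_fun [set: 'rV[R]_n]
    (fun x : 'rV[R]_n => x ord0 i : measurableTypeR R).
Proof.
move=> _ Y mY; rewrite setTI; apply: sub_sigma_algebra => /=.
rewrite -bigcup_seq/=; exists i => /=; first by rewrite mem_index_enum.
by exists Y => //; rewrite setTI.
Qed.

Lemma measurable_fun_rVP d (T : measurableType d) (R : realType) n
    (f : T -> 'rV[R]_n) :
  measurable_fun [set: T] f <->
  forall i, measurable_fun [set: T]
    (fun x => f x ord0 i : measurableTypeR R).
Proof.
split=> [mf i|mf].
  exact: (measurableT_comp (@measurable_coord R n i) mf).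
pose c (i : 'I_n) (x : 'rV[R]_n) : measurableTypeR R := x ord0 i.
apply: (measurability (\big[setU/set0]_(i < n)
  preimage_set_system setT (c i) measurable)) => //.
move=> _ [B + <-]; rewrite -bigcup_seq => -[i _ [C mC <-]].
by rewrite !setTI; have := mf i measurableT C mC; rewrite setTI.
Qed.

Section lebesgue_rV.
Context {R : realType}.

Definition rV_cons n (p : measurableTypeR R * 'rV[R]_n) : 'rV[R]_n.+1 :=
  row_mx (p.1%:M : 'rV_1) p.2 : 'rV_(1 + n).

Definition rV_uncons n (x : 'rV[R]_n.+1) : measurableTypeR R * 'rV[R]_n :=
  (x ord0 ord0, rsubmx (x : 'rV_(1 + n))).

Lemma rV_consK n : cancel (@rV_cons n) (@rV_uncons n).
Proof.
move=> [a v]; rewrite /rV_uncons /rV_cons row_mxKr; congr (_, _).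
by rewrite mxE; case: splitP => // j _; rewrite mxE (ord1 j) eqxx mulr1n.
Qed.

Lemma measurable_rV_cons n : measurable_fun setT (@rV_cons n).
Proof.
apply/measurable_fun_rVP => i.
rewrite -[i](splitK (i : 'I_(1 + n))).
case: (fintype.split _) => /= j; rewrite /rV_cons.
  rewrite (_ : (fun _ => _) = fst); first exact: measurable_fst.
  apply/funext => -[a v]; apply: etrans (row_mxEl _ _ _ _) _.
  by rewrite mxE (ord1 j) eqxx mulr1n.
rewrite (_ : (fun _ => _) = (fun x : 'rV[R]_n => x ord0 j) \o snd); last first.
  by apply/funext => -[a v]; exact: row_mxEr.
exact: measurableT_comp (@measurable_coord R n j) measurable_snd.
Qed.

Lemma measurable_rV_uncons n : measurable_fun setT (@rV_uncons n).
Proof.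
apply/measurable_fun_pairP; split; first exact: measurable_coord.
apply/measurable_fun_rVP => i.
rewrite (_ : (fun _ => _) =
  fun x : 'rV[R]_n.+1 => x ord0 (rshift 1 i : 'I_n.+1)).
  exact: (@measurable_coord R n.+1 (rshift 1 i)).
by apply/funext => x; rewrite /= mxE.
Qed.

Section step.
Variables (n : nat).
Variables (l : {sigma_finite_measure set (measurableTypeR R) -> \bar R}).
Variables (m : {sigma_finite_measure set 'rV[R]_n -> \bar R}).

Definition prod_rV : set 'rV[R]_n.+1 -> \bar R :=
  pushforward (l \x m)%E (@rV_cons n).

HB.instance Definition _ := Measure.copy prod_rV
  (measure_function_pushforward__canonical__measure_function_Measure
    (l \x m)%E (@measurable_rV_cons n)).

Let prod_rV_sigma_finite : sigma_finite setT prod_rV.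
Proof.
have /sigma_finiteP[F [TF ndF Foo]] := sigma_finiteT l.
have /sigma_finiteP[G [TG ndG Goo]] := sigma_finiteT m.
exists (fun k => @rV_uncons n @^-1` (F k `*` G k)).
  rewrite -preimage_bigcup -[LHS](preimage_setT (@rV_uncons n)).
  congr (_ @^-1` _); rewrite -setXTT TF TG predeqE => -[x y]; split.
    move=> [/= [i _ Fix] [j _ Gjy]]; exists (maxn i j) => //; split.
    - by move: x Fix; exact/subsetPset/ndF/leq_maxl.
    - by move: y Gjy; exact/subsetPset/ndG/leq_maxr.
  by move=> [i _ []/= ? ?]; split; exists i.
move=> k; have [mF Fk] := Foo k; have [mG Gk] := Goo k; split.
  rewrite -[X in measurable X]setTI; apply: measurable_rV_uncons => //.
  exact: measurableX.
rewrite /prod_rV /pushforward -comp_preimage.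
rewrite (_ : _ \o _ = id); last by apply/funext => x /=; rewrite rV_consK.
by rewrite preimage_id product_measure1E// lte_mul_pinfty// ge0_fin_numE.
Qed.

HB.instance Definition _ := Measure_isSigmaFinite.Build _ _ _
  prod_rV prod_rV_sigma_finite.

End step.

(* Lebesgue measure on R^n: R^0 has one point, of mass 1. *)
Fixpoint lebesgue_rV n : {sigma_finite_measure set 'rV[R]_n -> \bar R} :=
  match n with
  | 0 => dirac (0 : 'rV[R]_0)
  | k.+1 => prod_rV lebesgue_measure (lebesgue_rV k)
  end.

End lebesgue_rV.

Section gaussian_rV.
Context {R : realType} {n : nat}.

Definition gauss_rV_pdf (x : 'rV[R]_n) : R :=
  Num.sqrt (2 * pi) ^- n * expR (- (\sum_i x ord0 i ^+ 2) / 2).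

Lemma gauss_rV_pdf_ge0 x : 0 <= gauss_rV_pdf x.
Proof. by rewrite mulr_ge0 ?expR_ge0// invr_ge0 exprn_ge0// sqrtr_ge0. Qed.

Lemma measurable_gauss_rV_pdf :
  measurable_fun setT (gauss_rV_pdf : 'rV[R]_n -> measurableTypeR R).
Proof.
apply: measurable_funM => //; apply: measurableT_comp => //.
apply: measurable_funM => //; apply: measurableT_comp => //.
apply: measurable_sum => i; apply: measurable_funX.
exact: measurable_coord.
Qed.

Definition gauss_rV (A : set 'rV[R]_n) : \bar R :=
  (\int[lebesgue_rV n]_(x in A) (gauss_rV_pdf x)%:E)%E.

Let gauss_rV0 : gauss_rV set0 = 0%E.
Proof. by rewrite /gauss_rV integral_set0. Qed.

Let gauss_rV_ge0 A : (0 <= gauss_rV A)%E.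
Proof. by apply: integral_ge0 => x _; rewrite lee_fin gauss_rV_pdf_ge0. Qed.

Let gauss_rV_sigma_additive : semi_sigma_additive gauss_rV.
Proof.
move=> A mA tA mUA; rewrite /gauss_rV ge0_integral_bigcup//=.
- apply: is_cvg_ereal_nneg_natsum_cond => k _ _; exact: gauss_rV_ge0.
- apply/measurable_EFinP.
  exact: measurable_funS (subsetT _) measurable_gauss_rV_pdf.
- by move=> x _; rewrite lee_fin gauss_rV_pdf_ge0.
Qed.

HB.instance Definition _ := isMeasure.Build _ _ _
  gauss_rV gauss_rV0 gauss_rV_ge0 gauss_rV_sigma_additive.

End gaussian_rV.

(* [g] is a version of the density d nu / d m. *)
Definition has_density d (T : measurableType d) (R : realType)
    (m nu : set T -> \bar R) (g : T -> R) : Prop :=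
  [/\ measurable_fun setT g, forall x, 0 <= g x &
      forall A, measurable A -> nu A = (\int[m]_(x in A) (g x)%:E)%E].

(* C^k maps on the whole space; this is the usual notion only when [V] is
   finite-dimensional. *)
Fixpoint class_C (R : realType) (V W : normedModType R) (k : nat)
    (f : V -> W) : Prop :=
  match k with
  | 0 => continuous f
  | j.+1 => (forall x, differentiable f x) /\
            (forall v, class_C j (fun x => 'D_v f x))
  end.

Definition smooth (R : realType) (V W : normedModType R) (f : V -> W) : Prop :=
  forall k, class_C k f.

Section flow.
Context {R : realType} {n : nat}.

Definition gradient (g : 'rV[R]_n -> R) (x : 'rV[R]_n) : 'rV[R]_n :=
  \row_i 'D_(delta_mx 0 i) g x.

Definition laplacian (g : 'rV[R]_n -> R) (x : 'rV[R]_n) : R :=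
  \sum_i 'D_(delta_mx 0 i) (fun y => 'D_(delta_mx 0 i) g y) x.

Definition ornstein_uhlenbeck (t : R) (f : 'rV[R]_n -> R) (x : 'rV[R]_n) : R :=
  \int[gauss_rV]_y f (expR (- t) *: x + Num.sqrt (1 - expR (- 2 * t)) *: y).

(* Smoothness of (t, x) |-> Phi t x on [0, +oo[ x R^n, boundary included, i.e.
   the existence of a smooth extension to R x R^n. The values of [Phi] at
   negative times are irrelevant. *)
Definition smooth_flow (Phi : R -> 'rV[R]_n -> 'rV[R]_n) : Prop :=
  exists2 Psi : R * 'rV[R]_n -> 'rV[R]_n, smooth Psi &
    forall (t : R) (x : 'rV[R]_n), 0 <= t -> Phi t x = Psi (t, x).

Definition heat_flow_solution (f : 'rV[R]_n -> R)
    (Phi : R -> 'rV[R]_n -> 'rV[R]_n) : Prop :=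
  [/\ smooth_flow Phi,
      forall x, Phi 0 x = x &
      forall (t : R) (x : 'rV[R]_n), 0 < t ->
        is_derive t 1 (fun s => Phi s x)
          (- gradient (fun z => ln (ornstein_uhlenbeck t f z)) (Phi t x))].

Definition unique_heat_flow_solution (f : 'rV[R]_n -> R)
    (Phi : R -> 'rV[R]_n -> 'rV[R]_n) : Prop :=
  heat_flow_solution f Phi /\
  forall Phi', heat_flow_solution f Phi' ->
    forall (t : R) (x : 'rV[R]_n), 0 <= t -> Phi' t x = Phi t x.

End flow.

(* Main.v *)
(** Write [Q t = alpha + (1 - alpha) e^(-2t)], [a = e^(-t)], [s^2 = 1 - a^2].
    Completing the square, [P_t f x] is, up to a factor [C e^(- c |x|^2)] with
    [c = a^2 / (2 s^2)], the Laplace transform at [(a / s^2) x] of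
    [e^(- V - c |z|^2) dz].  Hence
    [- Laplacian (log P_t f) = 2 c n - (a / s^2)^2 tr Cov], where [Cov] is the
    covariance of the probability [p] proportional to
    [e^(- V - c |z|^2 + th.z)].  The potential of [p] has Laplacian at most
    [(alpha + 2 c) n], and a Cramer-Rao argument turns this into
    [tr Cov >= n / (alpha + 2 c)]; therefore [- Laplacian (log P_t f)] is at most
    [n (alpha - 1) a^2 / Q t = (n / 2) (log Q)'(t)].  By Liouville's formula it
    is the logarithmic derivative of [det (grad F_t)] along the flow, so
    [det (grad F_t)^2 / Q^n] is nonincreasing, equal to [1] at [t = 0], and
    [Q t] tends to [alpha]. *)
Require Import Defs.
From HB Require Import structures.
From mathcomp Require Import all_boot all_order all_algebra.
From mathcomp Require Import all_classical all_reals all_analysis.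
From mathcomp Require Import measurable_realfun ess_sup_inf perm ring lra.

Set Implicit Arguments.
Unset Strict Implicit.
Unset Printing Implicit Defensive.
Import Order.TTheory GRing.Theory Num.Theory.
Import numFieldNormedType.Exports.

Local Open Scope classical_set_scope.
Local Open Scope ring_scope.

(** * Differential calculus *)

(** Formally the Cramer-Rao step is one square. Let [psi] be the gradient of the potential of [p],
    [beta = alpha + 2 c] and [m] a point. Integrating by parts, the [p]-mean of [|psi|^2] is that of
    the Laplacian of the potential, at most [beta n], and the mean of [psi . (z - m)] is [n].
    Expanding [0 <= E |psi - beta (z - m)|^2] gives [n <= beta E |z - m|^2]; then [m] is taken to be
    the mean. The obstacle is to justify this when [V] is controlled only by an upper bound on its
    Laplacian: nothing is known about the growth of [V] or of its gradient. The integration by parts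
    is therefore done under a compactly supported cutoff, arranged so that [psi] survives only
    inside the square and the error is [eps] times a moment not involving [psi]. Existence and
    smoothness of moments come from the factor [e^(- c |z|^2)], available because [t > 0]. The
    function [Q] is read off the extremal case: if [mu] is the centred Gaussian of covariance
    [alpha^-1 I], then [F_t x = sqrt (Q t) x], so [det (grad F_t) = (Q t)^(n / 2)]. *)

Lemma is_derive_line (R : realType) (U W : normedModType R) (f : U -> W)
    (x v : U) (df : W) :
  is_derive x v f df <-> is_derive (0 : R) 1 (fun h => f (h *: v + x)) df.
Proof.
have E : 'D_v f x = 'D_1 (fun h : R => f (h *: v + x)) (0 : R).
  rewrite /derive.
  have -> : (fun h : R => h^-1 *: ((fun h => f (h *: v + x)) (h *: 1 + 0) -
      (fun h => f (h *: v + x)) 0)) = (fun h => h^-1 *: (f (h *: v + x) - f x)) => //.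
  by apply/funext => h; rewrite addr0 scale0r add0r [_%:A]mulr1.
split=> -[d <-].
  by rewrite E; apply: DeriveDef => //; exact: (iffLR (derivable1P _ _ _)).
by rewrite -E; apply: DeriveDef => //; exact: (iffRL (derivable1P _ _ _)).
Qed.

Lemma is_derive_comp1 (R : realType) (U : normedModType R) (phi : R -> R)
    (f : U -> R) (x v : U) (df dphi : R) :
  is_derive x v f df -> is_derive (f x) 1 phi dphi ->
  is_derive x v (fun y => phi (f y)) (dphi * df).
Proof.
move=> /is_derive_line [d1 E1] [d2 E2]; apply/is_derive_line.
set g := fun h : R => f (h *: v + x).
have g0 : g 0 = f x by rewrite /g scale0r add0r.
have d2' : derivable phi (g 0) 1 by rewrite g0.
have dd : derivable (phi \o g) 0 1.
  apply: (iffRL (derivable1_diffP _ _)); apply: differentiable_comp.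
    exact: (iffLR (derivable1_diffP _ _) d1).
  exact: (iffLR (derivable1_diffP _ _) d2').
have := @derive1_comp R g phi 0 d1 d2'.
by rewrite !derive1E g0 E2 (E1 : 'D_1 g 0 = df).
Qed.

(** An exponent of at least 2 smooths the kink at [0]. Used at exponents 3 and then 2, this makes
    the cutoff [eta] twice differentiable. *)
Lemma is_derive_maxX (R : realType) (k : nat) (x : R) :
  is_derive x 1 (fun x => Num.max 0 x ^+ k.+2) (k.+2%:R * Num.max 0 x ^+ k.+1).
Proof.
have [x0|x0|->] := ltgtP x 0.
- rewrite expr0n mulr0.
  apply: (@near_eq_is_derive _ _ _ (cst 0)).
  near=> y; rewrite max_l ?expr0n//.
  by apply: ltW; near: y; exact: lt_nbhsl.
- have D : is_derive x 1 (fun y : R => y ^+ k.+2) (k.+2%:R * x ^+ k.+1).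
    apply: DeriveDef; first exact: exprn_derivable.
    by rewrite exp_derive [_ *: _]mulr1.
  apply: near_eq_is_derive D; near=> y; rewrite max_r//.
  by apply: ltW; near: y; exact: lt_nbhsr.
rewrite ?maxxx expr0n mulr0.
have H : h^-1 * (Num.max 0 (h * 1 + 0) ^+ k.+2 - Num.max 0 0 ^+ k.+2)
    @[h --> (0 : R)^'] --> (0 : R).
  apply/cvgrPdist_le => e e0; near=> h.
  have h1 : `|h| <= 1 by near: h; exact: dnbhs0_le.
  have he : `|h| <= e by near: h; exact: dnbhs0_le.
  have h0 : h != 0 by near: h; exact: nbhs_dnbhs_neq.
  rewrite maxxx expr0n subr0 addr0 sub0r normrN mulr1 normrM normfV.
  rewrite ler_pdivrMl ?normr_gt0// (le_trans _ (ler_wpM2l _ he))//.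
  rewrite normrX -expr2; have m : `|Num.max 0 h| <= `|h|.
    by rewrite maxEle; case: ifP => //; rewrite normr0.
  rewrite -addn2 addnC exprD (le_trans _ (_ : `|Num.max 0 h| ^+ 2 * 1 <= _))//.
    by rewrite ler_wpM2l ?exprn_ge0// exprn_ile1// (le_trans m).
  by rewrite mulr1 lerXn2r// nnegrE.
apply: DeriveDef; first by apply/cvg_ex; exists 0.
exact/cvg_lim.
Unshelve. all: by end_near. Qed.

Lemma is_derive_along (R : realType) (U W : normedModType R) (f : U -> W)
    (x v : U) (h : R) (df : W) : is_derive (h *: v + x) v f df ->
  is_derive h 1 (fun k => f (k *: v + x)) df.
Proof.
move=> /is_derive_line D; apply/is_derive_line.
rewrite (_ : (fun _ => _) = (fun k : R => f (k *: v + (h *: v + x)))) => //.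
by apply/funext => k; rewrite addrA -scalerDl [k *: _]mulr1.
Qed.

(** Gives the bound on difference quotients, uniform in the step, that dominated convergence
    requires in [integral_derive_eq0]. *)
Lemma derive_along_le (R : realType) (U : normedModType R) (f df : U -> R)
    (x v : U) (h C : R) : 0 < h ->
  (forall y, is_derive y v f (df y)) -> (forall y, `|df y| <= C) ->
  `|f (h *: v + x) - f x| <= C * h.
Proof.
move=> h0 D dfC.
pose g k := f (k *: v + x).
have Dg (k : R) : is_derive k 1 g (df (k *: v + x)) by exact: is_derive_along.
have cg : {within `[0, h], continuous g}.
  apply: continuous_subspaceT => k; apply: differentiable_continuous.
  exact/derivable1_diffP.
have [c _] := MVT h0 (fun k _ => Dg k) cg.
rewrite /g scale0r add0r subr0 => ->.
by rewrite normrM (gtr0_norm h0) ler_wpM2r// ltW.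
Qed.

Section real_valued.
Context {R : realType} {U : normedModType R}.
Implicit Types (f g : U -> R) (x v : U) (df dg : R).

Lemma is_deriveDr f g x v df dg : is_derive x v f df -> is_derive x v g dg ->
  is_derive x v (fun y => f y + g y) (df + dg).
Proof. by move=> ? ?; exact: is_deriveD. Qed.

Lemma is_deriveNr f x v df : is_derive x v f df ->
  is_derive x v (fun y => - f y) (- df).
Proof. by move=> ?; exact: is_deriveN. Qed.

Lemma is_deriveBr f g x v df dg : is_derive x v f df -> is_derive x v g dg ->
  is_derive x v (fun y => f y - g y) (df - dg).
Proof. by move=> ? ?; exact: is_deriveB. Qed.

Lemma is_deriveMr f g x v df dg : is_derive x v f df -> is_derive x v g dg ->
  is_derive x v (fun y => f y * g y) (f x * dg + g x * df).
Proof. by move=> ? ?; exact: is_deriveM. Qed.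

Lemma is_deriveZr (k : R) g x v dg : is_derive x v g dg ->
  is_derive x v (fun y => k * g y) (k * dg).
Proof. by move=> ?; exact: is_deriveZ. Qed.

Lemma is_deriveVr f x v df : f x != 0 -> is_derive x v f df ->
  is_derive x v (fun y => (f y)^-1) (- (f x) ^- 2 * df).
Proof.
move=> fx0 [d <-]; apply: DeriveDef; first exact: derivableV.
exact: deriveV.
Qed.

Lemma is_derive_sumr (I : Type) (s : seq I) (F : I -> U -> R) (dF : I -> R) x v :
  (forall i, is_derive x v (F i) (dF i)) ->
  is_derive x v (fun y => \sum_(i <- s) F i y) (\sum_(i <- s) dF i).
Proof.
move=> D; elim: s => [|i s IH].
  by under eq_fun do rewrite big_nil; rewrite big_nil; exact: is_derive_cst.
by under eq_fun do rewrite big_cons; rewrite big_cons; exact: is_deriveDr.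
Qed.

End real_valued.

Section continuity.
Context {R : realType} {T : topologicalType}.
Implicit Types f g : T -> R.

Lemma continuousDr f g : continuous f -> continuous g ->
  continuous (fun z => f z + g z).
Proof. by move=> cf cg z; apply: continuousD; [exact: cf|exact: cg]. Qed.

Lemma continuousNr f : continuous f -> continuous (fun z => - f z).
Proof. by move=> cf z; apply: continuousN; exact: cf. Qed.

Lemma continuousBr f g : continuous f -> continuous g ->
  continuous (fun z => f z - g z).
Proof. by move=> cf cg; apply: continuousDr => //; exact: continuousNr. Qed.

Lemma continuousMr f g : continuous f -> continuous g ->
  continuous (fun z => f z * g z).
Proof. by move=> cf cg z; apply: continuousM; [exact: cf|exact: cg]. Qed.

Lemma continuousZr (k : R) f : continuous f -> continuous (fun z => k * f z).
Proof. by move=> cf; apply: continuousMr => //; exact: cst_continuous. Qed.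

Lemma continuousXr k f : continuous f -> continuous (fun z => f z ^+ k).
Proof.
move=> cf; elim: k => [|k IH]; first by exact: cst_continuous.
by under eq_fun do rewrite exprS; exact: continuousMr.
Qed.

Lemma continuous_expr f : continuous f -> continuous (fun z => expR (f z)).
Proof.
move=> cf z; apply: (@continuous_comp _ _ _ f expR); first exact: cf.
exact: continuous_expR.
Qed.

Lemma continuous_max0 f : continuous f -> continuous (fun z => Num.max 0 (f z)).
Proof.
move=> cf z; apply: (@continuous_max _ _ (cst 0) f); first exact: cst_continuous.
exact: cf.
Qed.

End continuity.

Lemma continuous_bigsum (R : realType) (T : topologicalType) (I : Type)
    (s : seq I) (g : I -> T -> R) :
  (forall i, continuous (g i)) -> continuous (fun z => \sum_(i <- s) g i z).
Proof.
move=> cg; elim: s => [|i s IH] z.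
  by under eq_fun do rewrite big_nil; exact: cvg_cst.
by under eq_fun do rewrite big_cons;
  apply: (@continuousD _ _ _ (g i)); [exact: cg|exact: IH].
Qed.

Lemma continuous_bigprod (R : realType) (T : topologicalType) (I : Type)
    (s : seq I) (g : I -> T -> R) :
  (forall i, continuous (g i)) -> continuous (fun z => \prod_(i <- s) g i z).
Proof.
move=> cg; elim: s => [|i s IH] z.
  by under eq_fun do rewrite big_nil; exact: cvg_cst.
by under eq_fun do rewrite big_cons;
  apply: (@continuousM _ _ (g i)); [exact: cg|exact: IH].
Qed.


Lemma is_derive_coord (R : realType) n (i j : 'I_n) (z : 'rV[R]_n) :
  is_derive z (delta_mx 0 i) (fun z : 'rV[R]_n => z ord0 j) (i == j)%:R.
Proof.
have E : 'd (fun z : 'rV[R]_n => z ord0 j) z (delta_mx 0 i) = (i == j)%:R :> R.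
  have @f : {linear 'rV[R]_n -> R}.
    by exists (fun N : 'rV[R]_n => N ord0 j); do 2![eexists]; do ?[constructor];
     rewrite ?mxE// => ? *; rewrite ?mxE//; move=> ?; rewrite !mxE.
  rewrite (@diff_lin _ _ _ f); last exact: coord_continuous.
  by rewrite /f /= mxE eqxx eq_sym.
apply: DeriveDef; first exact/diff_derivable/differentiable_coord.
by rewrite deriveE//; exact: differentiable_coord.
Qed.


Lemma is_derive_coord_same (R : realType) n (i : 'I_n) (z : 'rV[R]_n) :
  is_derive z (delta_mx 0 i) (fun z : 'rV[R]_n => z ord0 i) 1.
Proof. by have := is_derive_coord i i z; rewrite eqxx. Qed.

Lemma is_derive_entry (R : realType) (U : normedModType R) (m n : nat)
    (M : U -> 'M[R]_(m, n)) (x v : U) (dM : 'M[R]_(m, n)) i j :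
  is_derive x v M dM -> is_derive x v (fun y => M y i j) (dM i j).
Proof.
move=> [dMx <-]; apply: DeriveDef; first exact: ((derivable_mxP M x v).1 dMx).
by rewrite derive_mx// mxE.
Qed.

(* The limit of the symmetric second difference quotient is a mixed second
   derivative, in either order. *)
Lemma second_difference (R : realType) (U : normedModType R) (f : U -> R)
    (p v w : U) (e : R) : 0 < e ->
  (forall x, derivable f x v) -> differentiable ('D_v f) p ->
  exists2 d, 0 < d & forall h : R, 0 < h < d ->
    `|f (h *: v + (h *: w + p)) - f (h *: w + p) - (f (h *: v + p) - f p)
      - h ^+ 2 * 'D_w ('D_v f) p| <= e * h ^+ 2.
Proof.
move=> e0 dv dd.
pose N := 2 * `|v| + `|w| + 1.
have N0 : 0 < N by rewrite ltr_wpDl// addr_ge0// mulr_ge0.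
have e'0 : 0 < e / N by rewrite divr_gt0.
pose g y := 'D_v f (y + p) - 'D_v f p - 'd ('D_v f) p y.
have [r r0 hr] : exists2 r, 0 < r & forall y : U, `|y| < r -> `|g y| <= e / N * `|y|.
  have := (diff_locallyP _ _).1 dd => -[_] /eqaddoP /(_ _ e'0).
  move=> /nbhs_normP[r r0 hr]; exists r => // y yr.
  have := hr y; rewrite /ball_/= sub0r normrN => /(_ yr).
  rewrite -[(_ - _) y]/('D_v f (y + p) - ('D_v f p + 'd ('D_v f) p y)).
  by rewrite /g opprD addrA.
exists (r / N); first exact: divr_gt0.
move=> h /andP[h0 hN].
(* The second difference is an increment of [phi] over [[0, h]]. One use of the mean value theorem
   leaves a difference of two values of ['D_v f] near [p], and differentiability at [p] alone
   expands both. *)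
pose phi s := f (s *: v + (h *: w + p)) - f (s *: v + p).
have dphi (s : R) : is_derive s 1 phi
    ('D_v f (s *: v + (h *: w + p)) - 'D_v f (s *: v + p)).
  by apply: is_deriveBr; apply: is_derive_along; exact: derivableP.
have cphi : {within `[0, h], continuous phi}.
  apply: continuous_subspaceT => s; apply: differentiable_continuous.
  exact/derivable1_diffP.
have [s] := MVT h0 (fun s _ => dphi s) cphi.
rewrite in_itv/= => /andP[s0 sh]; rewrite {1 2}/phi !scale0r !add0r subr0.
have lt_r (y : U) : `|y| <= h * N -> `|y| < r.
  by move=> /le_lt_trans; apply; rewrite -ltr_pdivlMr.
have sv : `|s *: v| <= h * `|v|.
  by rewrite normrZ gtr0_norm// ler_wpM2r// ltW.
have n1 : `|s *: v| <= h * N.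
  rewrite (le_trans sv)// ler_wpM2l ?(ltW h0)// /N.
  have := normr_ge0 v; have := normr_ge0 w; lra.
have n2 : `|s *: v + h *: w| <= h * (`|v| + `|w|).
  by rewrite (le_trans (ler_normD _ _))// mulrDr lerD// normrZ gtr0_norm.
have n2' : `|s *: v + h *: w| <= h * N.
  rewrite (le_trans n2)// ler_wpM2l ?(ltW h0)// /N.
  have := normr_ge0 v; have := normr_ge0 w; lra.
have g1 := hr _ (lt_r _ n1); have g2 := hr _ (lt_r _ n2').
move=> E.
have -> : f (h *: v + (h *: w + p)) - f (h *: w + p) - (f (h *: v + p) - f p)
  = f (h *: v + (h *: w + p)) - f (h *: v + p) - (f (h *: w + p) - f p) by ring.
rewrite E.
have -> : ('D_v f (s *: v + (h *: w + p)) - 'D_v f (s *: v + p)) * h -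
   h ^+ 2 * 'D_w ('D_v f) p = h * (g (s *: v + h *: w) - g (s *: v)).
  have -> : g (s *: v + h *: w) = 'D_v f (s *: v + (h *: w + p)) - 'D_v f p -
      ('d ('D_v f) p (s *: v) + h * 'D_w ('D_v f) p).
    rewrite /g addrA; congr (_ - _ - _).
    by rewrite linearD; congr (_ + _); rewrite linearZ/= deriveE.
  by rewrite /g; ring.
rewrite normrM gtr0_norm// expr2 mulrCA ler_wpM2l ?(ltW h0)//.
rewrite (le_trans (ler_normB _ _))//.
have -> : e * h = e / N * (h * N) by field; rewrite gt_eqF.
apply: (le_trans (lerD g2 g1)); rewrite -mulrDr ler_wpM2l ?(ltW e'0)//.
apply: (le_trans (lerD n2 sv)); rewrite -mulrDr ler_wpM2l ?(ltW h0)// /N.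
lra.
Qed.

Lemma close_quotients (R : realFieldType) (S a b d k : R) : 0 < d ->
  `|S - d * a| <= k * d -> `|S - d * b| <= k * d -> `|a - b| <= 2 * k.
Proof.
move=> d0 ha hb; rewrite -(ler_pM2l d0) -[d in leLHS]gtr0_norm// -normrM.
have -> : d * (a - b) = (S - d * b) - (S - d * a) by ring.
by rewrite (le_trans (ler_normB _ _))// (le_trans (lerD hb ha))//; lra.
Qed.

(** The second difference is symmetric in [v] and [w], so both mixed derivatives approximate the
    same quantity. With error [D / 3] on each side their distance [D] would be at most
    [2 * (D / 3)]. *)
Lemma derive_swap (R : realType) (U : normedModType R) (f : U -> R) (p v w : U) :
  (forall x, derivable f x v) -> (forall x, derivable f x w) ->
  differentiable ('D_v f) p -> differentiable ('D_w f) p ->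
  'D_w ('D_v f) p = 'D_v ('D_w f) p.
Proof.
move=> dv dw ddv ddw; apply/eqP; rewrite -subr_eq0 -normr_eq0; apply/negPn/negP => D0.
set D := `| _ | in D0.
have D1 : 0 < D by rewrite lt_neqAle eq_sym D0 normr_ge0.
have e0 : 0 < D / 3 by rewrite divr_gt0.
have [d1 d10 h1] := second_difference w e0 dv ddv.
have [d2 d20 h2] := second_difference v e0 dw ddw.
pose h := Num.min d1 d2 / 2.
have h0 : 0 < h by rewrite divr_gt0// lt_min d10.
have hd1 : h < d1.
  rewrite /h ltr_pdivrMr// (@le_lt_trans _ _ d1)//; last lra.
  by rewrite ge_min lexx.
have hd2 : h < d2.
  rewrite /h ltr_pdivrMr// (@le_lt_trans _ _ d2)//; last lra.
  by rewrite ge_min lexx orbT.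
have := h1 h; rewrite h0 hd1 => /(_ isT) H1.
have := h2 h; rewrite h0 hd2 => /(_ isT) H2.
have h20 : 0 < h ^+ 2 by rewrite exprn_gt0.
rewrite (addrCA (h *: w)) in H2.
have : D <= 2 * (D / 3).
  apply: (close_quotients h20 H1); apply: le_trans H2.
  by rewrite le_eqVlt; apply/orP; left; apply/eqP; congr (`| _ |); ring.
by move=> HD; move: D1 HD; generalize D => x; clear; lra.
Qed.

(** The test [j == i] singles out a factor by its index and not by its position, hence [uniq s]. *)
Lemma is_derive_prodr (R : realType) (U : normedModType R) (I : eqType)
    (s : seq I) (F : I -> U -> R) (dF : I -> R) (x v : U) : uniq s ->
  (forall i, is_derive x v (F i) (dF i)) ->
  is_derive x v (fun y => \prod_(i <- s) F i y)
    (\sum_(i <- s) \prod_(j <- s) (if j == i then dF j else F j x)).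
Proof.
move=> + D; elim: s => [_|i s IH /= /andP[si us]].
  by under eq_fun do rewrite big_nil; rewrite big_nil; exact: is_derive_cst.
under eq_fun do rewrite big_cons.
apply: (is_derive_eq (is_deriveMr (D i) (IH us))).
rewrite [RHS]big_cons big_cons eqxx addrC; congr (_ + _).
  rewrite mulrC; congr (_ * _); apply: eq_big_seq => j js.
  by case: eqP => // ji; rewrite -ji js in si.
rewrite mulr_sumr; apply: eq_big_seq => j js; rewrite big_cons.
by case: eqP => // ij; rewrite ij js in si.
Qed.

(** Jacobi's formula for [J' = J A]. It goes through the adjugate, by
    [tr (J A adj J) = tr A * det J], and so also covers singular [J t]. *)
Lemma is_derive_det (R : realType) (n : nat) (J : R -> 'M[R]_n) (A : 'M[R]_n)
    (t : R) :
  (forall i j, is_derive t 1 (fun s => J s i j) ((J t *m A) i j)) ->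
  is_derive t 1 (fun s => \det (J s)) (\tr A * \det (J t)).
Proof.
move=> D.
have -> : \tr A * \det (J t) =
    \sum_(s : 'S_n) (-1) ^+ s * \sum_i \prod_j
      (if j == i then (J t *m A) j (s j) else J t j (s j)).
  transitivity (\sum_i \sum_k (J t *m A) i k * cofactor (J t) i k).
    transitivity (\tr (J t *m A *m \adj (J t))).
      rewrite mxtrace_mulC mulmxA mul_adj_mx mul_scalar_mx linearZ/= mulrC//.
    rewrite /mxtrace; apply: eq_bigr => i _; rewrite mxE.
    by under eq_bigr do rewrite [\adj _ _ _]mxE.
  under [RHS]eq_bigr do rewrite mulr_sumr.
  rewrite [RHS]exchange_big/=; apply: eq_bigr => i _.
  (* The Leibniz terms in which row [i] is differentiated add up to the determinant of [J t] with
     that row replaced. Expanding along row [i] leaves the cofactors of [J t], which do not see the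
     replaced row. *)
  pose M := \matrix_(j, k) (if j == i then (J t *m A) j k else J t j k).
  transitivity (\det M).
    rewrite (expand_det_row M i); apply: eq_bigr => k _; rewrite !mxE eqxx.
    congr (_ * _); rewrite /cofactor; congr (_ * \det _).
    by apply/matrixP => a b; rewrite !mxE eq_sym (negbTE (neq_lift _ _)).
  by apply: eq_bigr => s _; congr (_ * _); apply: eq_bigr => j _; rewrite mxE.
apply: is_derive_sumr => s; apply: is_deriveZr.
by apply: is_derive_prodr; exact: index_enum_uniq.
Qed.

(** * Integration on R^n *)

(** The image of Lebesgue measure under [y |-> b + s * y], multiplied by [s], agrees with Lebesgue
    measure on half-open intervals, hence everywhere. *)
Lemma ge0_integral_lebesgue_affine (R : realType) (b s : R)
    (g : measurableTypeR R -> \bar R) : 0 < s ->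
  measurable_fun setT g -> (forall z, 0 <= g z)%E ->
  (s%:E * (\int[lebesgue_measure]_y g (b + s * y)%R) =
   \int[lebesgue_measure]_z g z)%E.
Proof.
move=> s0 mg g0; pose h (y : measurableTypeR R) : measurableTypeR R := b + s * y.
have mh : measurable_fun setT h.
  by apply: measurable_funD => //; apply: measurable_funM.
pose pf := measure_function_pushforward__canonical__measure_function_Measure
  (@lebesgue_measure R) mh.
pose m' : {measure set (measurableTypeR R) -> \bar R} :=
  mscale (NngNum (ltW s0)) pf.
have mE A : measurable A -> lebesgue_measure A = m' A.
  apply: lebesgue_measure_unique => _ /ocitvP[->|[[u v] /= uv ->]].
    by rewrite !measure0.
  rewrite /m' /= /mscale /= /pushforward.
  have -> : h @^-1` `]u, v]%classic = `]((u - b) / s), ((v - b) / s)]%classic.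
    apply/seteqP; split => y /=; rewrite !in_itv /= /h ltr_pdivrMr// ler_pdivlMr//.
      by move=> /andP[? ?]; apply/andP; split; lra.
    by move=> /andP[? ?]; apply/andP; split; lra.
  rewrite !lebesgue_measure_itv /= !lte_fin uv ltr_pM2r ?invr_gt0// ltrD2r uv.
  rewrite -!EFinB -EFinM; congr (_%:E); field.
  by rewrite gt_eqF.
rewrite [RHS](eq_measure_integral m') => [|A mA _]; last exact: mE.
rewrite /m' ge0_integral_mscale//.
by rewrite ge0_integral_pushforward.
Qed.

Lemma ge0_integral_lebesgue_rVS (R : realType) n (g : 'rV[R]_n.+1 -> \bar R) :
  measurable_fun setT g -> (forall z, 0 <= g z)%E ->
  (\int[lebesgue_rV n.+1]_z g z =
   \int[lebesgue_measure]_u \int[lebesgue_rV n]_v g (rV_cons (u, v)))%E.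
Proof.
move=> mg g0.
transitivity (\int[lebesgue_measure \x lebesgue_rV n]_p g (rV_cons p))%E.
  rewrite (@ge0_integral_pushforward _ _ _ _ _ _ (@measurable_rV_cons R n)
     (lebesgue_measure \x lebesgue_rV n)%E setT g)//.
rewrite fubini_tonelli1 => [//||].
- exact: measurableT_comp (@measurable_rV_cons R n).
- by move=> p; exact: g0.
Qed.

Lemma rV_unconsK (R : realType) n : cancel (@rV_uncons R n) (@rV_cons R n).
Proof.
move=> x; apply: etrans (@hsubmxK _ 1 1 n x); congr (row_mx _ _).
apply/rowP => i; rewrite !mxE (ord1 i) eqxx mulr1n; congr (x _ _).
exact: val_inj.
Qed.

Lemma measurable_rV_affine (R : realType) n (b : 'rV[R]_n) (s : R) :
  measurable_fun setT (fun y : 'rV[R]_n => b + s *: y).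
Proof.
apply/measurable_fun_rVP => i.
rewrite (_ : (fun _ => _) = (fun y : 'rV[R]_n => b ord0 i + s * y ord0 i)).
  apply: measurable_funD => //; apply: measurable_funM => //.
  exact: measurable_coord.
by apply/funext => y; rewrite !mxE.
Qed.

Lemma ge0_integral_lebesgue_rV_affine (R : realType) n (b : 'rV[R]_n) (s : R)
    (g : 'rV[R]_n -> \bar R) : 0 < s ->
  measurable_fun setT g -> (forall z, 0 <= g z)%E ->
  ((s ^+ n)%:E * (\int[lebesgue_rV n]_y g (b + s *: y)%R) =
   \int[lebesgue_rV n]_z g z)%E.
Proof.
move=> s0; elim: n => [|n IH] in b g *; move=> mg g0.
  rewrite expr0 mul1e /=; apply: eq_integral => y _; congr g.
  by apply/rowP => -[].
have mg' : measurable_fun setT (fun y : 'rV[R]_n.+1 => g (b + s *: y)).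
  exact: measurableT_comp (measurable_rV_affine _ _).
rewrite ge0_integral_lebesgue_rVS// ge0_integral_lebesgue_rVS//.
pose c := (rV_uncons b).1; pose b' := (rV_uncons b).2.
have affE u v : b + s *: rV_cons (u, v) =
    rV_cons (c + s * u : measurableTypeR R, b' + s *: v).
  rewrite -[b]rV_unconsK /c /b'; case: (rV_uncons b) => b0 b1 /=.
  apply/rowP => i; rewrite /rV_cons !mxE.
  case: (fintype.split _) => j; rewrite !mxE//.
  by rewrite (ord1 j) eqxx !mulr1n.
pose G (u : measurableTypeR R) := (\int[lebesgue_rV n]_v g (rV_cons (u, v)))%E.
have mgc : measurable_fun setT (fun p => g (@rV_cons R n p)).
  exact: measurableT_comp (@measurable_rV_cons R n).
have mG : measurable_fun setT G.
  exact: (measurable_fun_fubini_tonelli_F (m2 := lebesgue_rV n) _ mgc).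
have G0 u : (0 <= G u)%E by apply: integral_ge0.
rewrite -/(G _) exprS EFinM -muleA.
rewrite -(ge0_integral_lebesgue_affine c s0 mG G0); congr (_ * _)%E.
under eq_integral do (under eq_integral do rewrite affE).
have mGc : measurable_fun setT
    (fun u : measurableTypeR R => c + s * u : measurableTypeR R).
  by apply: measurable_funD => //; apply: measurable_funM.
rewrite -ge0_integralZl//.
- apply: eq_integral => u _.
  apply: (IH b' (fun w => g (rV_cons (c + s * u : measurableTypeR R, w)))) => //.
  exact: (measurableT_comp mgc (pair1_measurable _)).
- rewrite (_ : (fun _ => _) = fun u : measurableTypeR R =>
    (\int[lebesgue_rV n]_v g (b + s *: rV_cons (u, v))%R)%E).
    apply: (measurable_fun_fubini_tonelli_F (m2 := lebesgue_rV n)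
     (fun p => g (b + s *: rV_cons p))) => //.
    exact: measurableT_comp mg' (@measurable_rV_cons R n).
  by apply/funext => u; apply: eq_integral => v _; rewrite affE.
- by move=> u _; apply: integral_ge0.
- by rewrite lee_fin exprn_ge0// ltW.
Qed.

Import HBNNSimple.

Lemma ge0_integral_nnsfun_density d (T : measurableType d) (R : realType)
    (m nu : {measure set T -> \bar R}) (g : T -> R) (h : {nnsfun T >-> R}) :
  has_density m nu g ->
  (\int[nu]_x (h x)%:E = \int[m]_x ((h x)%:E * (g x)%:E))%E.
Proof.
move=> [mg g0 nuE]; rewrite integralT_nnsfun sintegralE.
under [RHS]eq_integral => x _.
  rewrite fimfunE -fsumEFin// ge0_mule_fsuml; last first.
    by move=> r; exact: nnfun_muleindic_ge0.
  over.
have mi r : measurable_fun setT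
    (fun x => (r * \1_(h @^-1` [set r]) x)%:E * (g x)%:E)%E.
  apply: emeasurable_funM; last exact/measurable_EFinP.
  by apply/measurable_EFinP/measurable_funM.
rewrite ge0_integral_fsum//; last first.
  by move=> r x _; rewrite mule_ge0 ?lee_fin//; exact: nnfun_muleindic_ge0.
apply: eq_fsbigr => r /[!inE] -[x _ <-].
have mA : measurable (h @^-1` [set h x]) by [].
rewrite nuE// (integral_mkcond (h @^-1` _)) -ge0_integralZl//.
- apply: eq_integral => y _; rewrite EFinM -muleA; congr (_ * _)%E.
  rewrite patchE indicE; case: ifPn => // _; first by rewrite mul1e.
  by rewrite mul0e.
- by apply/(measurable_restrictT _ _).1 => //; exact/measurable_EFinP/measurable_funTS.
- by move=> y _; rewrite patchE; case: ifPn => //; rewrite lee_fin.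
- by rewrite lee_fin.
Qed.

Lemma ge0_integral_density d (T : measurableType d) (R : realType)
    (m nu : {measure set T -> \bar R}) (g : T -> R) (f : T -> \bar R) :
  has_density m nu g -> measurable_fun setT f -> (forall x, 0 <= f x)%E ->
  (\int[nu]_x f x = \int[m]_x (f x * (g x)%:E))%E.
Proof.
move=> dg mf f0; have [mg g0 _] := dg.
pose f_ := nnsfun_approx measurableT mf.
have nd_f x : {homo f_^~ x : i j / (i <= j)%N >-> i <= j}.
  by move=> i j ij; exact/lefP/nd_nnsfun_approx.
have cf x : (f_ n x)%:E @[n --> \oo] --> f x by exact: cvg_nnsfun_approx.
transitivity (limn (fun n => \int[nu]_x (f_ n x)%:E))%E.
  rewrite -monotone_convergence//.
  - by apply: eq_integral => x _; apply/esym/cvg_lim.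
  - by move=> n; exact/measurable_EFinP.
  - by move=> n x _; rewrite lee_fin.
  - by move=> x _ i j ij; rewrite lee_fin; exact: nd_f.
rewrite [X in limn X](_ : _ =
    (fun n => \int[m]_x ((f_ n x)%:E * (g x)%:E))%E); last first.
  by apply/funext => n; exact: ge0_integral_nnsfun_density.
rewrite -monotone_convergence//.
- apply: eq_integral => x _; apply/cvg_lim => //.
  by apply: cvgeZr => //; exact: cf.
- by move=> n; apply: emeasurable_funM; exact/measurable_EFinP.
- by move=> n x _; rewrite mule_ge0 ?lee_fin.
- by move=> x _ i j ij; rewrite lee_wpmul2r ?lee_fin//; exact: nd_f.
Qed.

(* A continuous function is the pointwise limit of its values at the
   truncations of its argument to the grids of step [1 / k.+1]. *)
Lemma continuous_measurable_rV (R : realType) n (f : 'rV[R]_n -> R) :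
  continuous f -> measurable_fun setT f.
Proof.
move=> cf.
(* The sigma-algebra is generated by the coordinates, so openness of preimages does not yield
   measurability at once. The map [q k] has countably many values, each taken on a product of
   half-open intervals. *)
pose q k (x : 'rV[R]_n) : 'rV[int]_n := \row_i Num.floor (k.+1%:R * x ord0 i).
pose r k (v : 'rV[int]_n) : 'rV[R]_n := \row_i ((v ord0 i)%:~R / k.+1%:R).
have mq k v : measurable (q k @^-1` [set v]).
  have -> : q k @^-1` [set v] = \bigcap_(i in [set: 'I_n])
     ((fun x : 'rV[R]_n => x ord0 i) @^-1`
       `[(v ord0 i)%:~R / k.+1%:R, (v ord0 i + 1)%:~R / k.+1%:R[).
    have E (x : 'rV[R]_n) i : (Num.floor (k.+1%:R * x ord0 i) = v ord0 i) <->
        (x ord0 i \in `[(v ord0 i)%:~R / k.+1%:R, (v ord0 i + 1)%:~R / k.+1%:R[).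
      rewrite in_itv/= ler_pdivrMr// ltr_pdivlMr// mulrC -floor_eq.
      by split => [->|/eqP].
    apply/seteqP; split => x /=.
      by move=> xv i _; apply/E; rewrite -xv mxE.
    by move=> h; apply/rowP => i; rewrite mxE; apply/E/h.
  apply: fin_bigcap_measurable => // i _.
  by rewrite -[X in measurable X]setTI; apply: measurable_coord.
apply: (@measurable_fun_cvg _ _ _ _ (fun k x => f (r k (q k x)))).
  move=> k _ Y mY; rewrite setTI.
  have -> : (fun x => f (r k (q k x))) @^-1` Y =
      \bigcup_(v in [set: 'rV[int]_n])
        (if f (r k v) \in Y then q k @^-1` [set v] else set0).
    apply/seteqP; split => x /=.
      by move=> fY; exists (q k x) => //; rewrite mem_set.
    by move=> [v _]; case: ifPn => //; rewrite inE => ? /= ->.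
  apply: countable_bigcupT_measurable => //.
  by move=> v; case: ifP.
move=> x _; apply: continuous_cvg; first exact: cf.
apply/cvgrPdist_le => e e0; near=> k.
rewrite [leLHS]/Num.Def.normr/= mx_normrE (bigmax_le _ (ltW e0))//= => -[i j] _ /=.
rewrite !mxE (ord1 i).
have k0 : 0 < k.+1%:R :> R by [].
have -> : x 0 j - (Num.floor (k.+1%:R * x ord0 j))%:~R / k.+1%:R =
   (k.+1%:R * x ord0 j - (Num.floor (k.+1%:R * x ord0 j))%:~R) / k.+1%:R.
  by rewrite mulrBl mulrAC divff ?mul1r ?gt_eqF.
have /andP[h1 h2] := floor_itv (k.+1%:R * x ord0 j).
rewrite ger0_norm ?divr_ge0 ?subr_ge0//.
apply: (@le_trans _ _ (k.+1%:R^-1)).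
  by rewrite ler_piMl ?invr_ge0// lerBlDl; move: h2; rewrite intrD => /ltW.
by apply: ltW; near: k; exact: near_infty_natSinv_lt (PosNum e0).
Unshelve. all: by end_near. Qed.

(** * The Ornstein-Uhlenbeck semigroup as a Laplace transform *)

Definition sqn {R : realType} {n} (x : 'rV[R]_n) : R := \sum_i x ord0 i ^+ 2.

Definition dot {R : realType} {n} (x y : 'rV[R]_n) : R :=
  \sum_i x ord0 i * y ord0 i.

Lemma dotDl (R : realType) n (x y z : 'rV[R]_n) :
  dot (x + y) z = dot x z + dot y z.
Proof. by rewrite /dot -big_split/=; apply: eq_bigr => i _; rewrite mxE mulrDl. Qed.

Definition tilt {R : realType} {n} (V : 'rV[R]_n -> R) (c : R)
  (th z : 'rV[R]_n) : R := expR (- V z - c * sqn z + dot th z).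

(** Left unnormalised, so that it is linear in [g] and differentiating in [th] multiplies [g] by a
    coordinate. At [g = cst 1] it is the Laplace transform, the normalising constant of [p]. *)
Definition moment {R : realType} {n} (V : 'rV[R]_n -> R) (c : R)
    (g : 'rV[R]_n -> R) (th : 'rV[R]_n) : R :=
  \int[lebesgue_rV n]_z (g z * tilt V c th z).

Lemma measurable_sqn (R : realType) n :
  measurable_fun setT (sqn : 'rV[R]_n -> R).
Proof.
apply: measurable_sum => i; apply: measurable_funX; exact: measurable_coord.
Qed.

Lemma measurable_dot (R : realType) n (th : 'rV[R]_n) :
  measurable_fun setT (dot th).
Proof.
apply: measurable_sum => i; apply: measurable_funM => //.
exact: measurable_coord.
Qed.

(** Infinite values are harmless: [r > 0] preserves them and [fine] sends them to [0]. Constants can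
    thus leave an integral before its finiteness is known. *)
Lemma fineZ (R : realType) (r : R) (x : \bar R) : 0 < r ->
  fine (r%:E * x) = r * fine x.
Proof.
by case: x => [x|r0|r0] //=; rewrite ?gt0_muley ?gt0_muleNy ?lte_fin// mulr0.
Qed.

Lemma gauss_rV_has_density (R : realType) n :
  has_density (lebesgue_rV n) gauss_rV (@gauss_rV_pdf R n).
Proof.
split => //; first exact: measurable_gauss_rV_pdf.
exact: gauss_rV_pdf_ge0.
Qed.

Lemma gauss_rV_pdf_gt0 (R : realType) n (x : 'rV[R]_n) : 0 < gauss_rV_pdf x.
Proof.
by rewrite mulr_gt0 ?expR_gt0// invr_gt0 exprn_gt0// sqrtr_gt0 mulr_gt0// pi_gt0.
Qed.

(** Both sides integrate to [mu] over every measurable set. As [f] is just one version of the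
    density, equality holds only almost everywhere; this suffices because for [t > 0] the kernel of
    the semigroup has a Lebesgue density. *)
Lemma ae_density_gauss_rV (R : realType) n (mu : probability 'rV[R]_n R)
    (p f : 'rV[R]_n -> R) :
  has_density (lebesgue_rV n) mu p -> has_density gauss_rV mu f ->
  ae_eq (lebesgue_rV n) setT (EFin \o p)
    (fun z => (f z * gauss_rV_pdf z)%:E).
Proof.
move=> [mp p0 pE] [mf f0 fE].
have mpdf := @measurable_gauss_rV_pdf R n.
apply: integral_ae_eq => //.
- apply/integrableP; split; first exact/measurable_EFinP.
  under eq_integral do rewrite gee0_abs ?lee_fin//.
  by rewrite -pE// probability_setT ltry.
- by apply/measurable_EFinP/measurable_funM.
move=> E _ mE; rewrite -pE// fE// [LHS]integral_mkcond.
have mfE : measurable_fun setT ((EFin \o f) \_ E).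
  by apply/(measurable_restrictT _ _).1 => //; exact/measurable_EFinP/measurable_funTS.
rewrite (ge0_integral_density (@gauss_rV_has_density R n))//; last first.
  by move=> x; rewrite patchE; case: ifPn => //; rewrite lee_fin.
rewrite [RHS]integral_mkcond; apply: eq_integral => x _.
by rewrite !patchE; case: ifPn => // _; rewrite mul0e.
Qed.

Lemma gauss_rV_pdf_ratio (R : realType) n (a s : R) (x z : 'rV[R]_n) : 0 < s ->
  s ^+ 2 = 1 - a ^+ 2 ->
  gauss_rV_pdf (s^-1 *: (z - a *: x)) / gauss_rV_pdf z =
  expR (- (a ^+ 2 / (2 * s ^+ 2) * sqn x)) *
  expR (- (a ^+ 2 / (2 * s ^+ 2)) * sqn z + dot (a / s ^+ 2 *: x) z).
Proof.
move=> s0 sE; rewrite /gauss_rV_pdf.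
have N0 : Num.sqrt (2 * pi) ^- n != 0 :> R.
  by rewrite invr_neq0// expf_neq0// gt_eqF// sqrtr_gt0 mulr_gt0// pi_gt0.
rewrite -mulf_div divff// mul1r -expRN -!expRD; congr expR.
rewrite /sqn /dot !mulNr !mulrA !mulr_suml !mulr_sumr -!sumrN -!big_split/=.
apply: eq_bigr => i _; rewrite !mxE.
have K : (s ^+ 2)^-1 - (s ^+ 2)^-1 * a ^+ 2 = 1.
  by rewrite -{1}[(s ^+ 2)^-1]mulr1 -mulrBr -sE mulVf// gt_eqF// exprn_gt0.
set u := z _ _; set v := x _ _.
apply/eqP; rewrite -subr_eq0; apply/eqP.
(* Only the coefficient of [u ^+ 2] depends on the relation between [a] and [s]. The discrepancy is
   isolated as a multiple of [1 - K]'s left side, which vanishes. *)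
transitivity (u ^+ 2 / 2 * (1 - ((s ^+ 2)^-1 - (s ^+ 2)^-1 * a ^+ 2))).
  by field; rewrite gt_eqF.
by rewrite K subrr mulr0.
Qed.

Lemma ornstein_uhlenbeck_moment (R : realType) n (V : 'rV[R]_n -> R)
    (mu : probability 'rV[R]_n R) (f : 'rV[R]_n -> R) (t : R) x :
  has_density (lebesgue_rV n) mu (fun x => expR (- V x)) ->
  has_density gauss_rV mu f -> 0 < t ->
  let a := expR (- t) in let s := Num.sqrt (1 - expR (- 2 * t)) in
  let c := a ^+ 2 / (2 * s ^+ 2) in
  ornstein_uhlenbeck t f x =
  s ^- n * expR (- (c * sqn x)) * moment V c (cst 1) (a / s ^+ 2 *: x).
Proof.
move=> dV df t0 a s c; have [mV _ _] := dV; have [mf f0 _] := df.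
have a2 : expR (- 2 * t) = a ^+ 2 by rewrite -expRM_natl mulrN mulNr.
have a21 : a ^+ 2 < 1 by rewrite -a2 expR_lt1 mulNr oppr_lt0 mulr_gt0.
have s0 : 0 < s by rewrite sqrtr_gt0 a2 subr_gt0.
have sE : s ^+ 2 = 1 - a ^+ 2 by rewrite sqr_sqrtr a2// subr_ge0 ltW.
have maff := measurable_rV_affine (a *: x) s.
(* The integrand, up to the factor [s ^- n], after the substitution [z = a x + s y]. *)
pose g z := f z * gauss_rV_pdf (s^-1 *: (z - a *: x)).
have mg : measurable_fun setT g.
  apply: measurable_funM => //.
  apply: measurableT_comp; first exact: measurable_gauss_rV_pdf.
  rewrite (_ : (fun _ => _) = (fun z => s^-1 *: (- (a *: x)) + s^-1 *: z)).
    exact: measurable_rV_affine.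
  by apply/funext => z; rewrite scalerBr scalerN addrC.
(* Here [f] is replaced by the everywhere defined quotient of [expR (- V z)] by the Gaussian
   density, which [gauss_rV_pdf_ratio] turns into a tilt. *)
pose w z := expR (- V z) * (gauss_rV_pdf (s^-1 *: (z - a *: x)) / gauss_rV_pdf z).
have wE z : w z = expR (- (c * sqn x)) * tilt V c (a / s ^+ 2 *: x) z.
  rewrite /w gauss_rV_pdf_ratio// -/c /tilt mulrCA; congr (_ * _).
  by rewrite -expRD addrA mulNr.
have mtilt : measurable_fun setT (tilt V c (a / s ^+ 2 *: x)).
  rewrite (_ : tilt _ _ _ = fun z => expR (- V z) *
      expR (- c * sqn z + dot (a / s ^+ 2 *: x) z)).
    apply: measurable_funM => //; apply: measurableT_comp => //.
    apply: measurable_funD; last exact: measurable_dot.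
    by apply: measurable_funM => //; exact: measurable_sqn.
  by apply/funext => z; rewrite /tilt -expRD addrA mulNr.
have mw : measurable_fun setT w.
  by rewrite (funext wE); apply: measurable_funM.
have w0 z : 0 <= w z by rewrite wE mulr_ge0// expR_ge0.
rewrite /ornstein_uhlenbeck -/s -/a.
have -> : (\int[gauss_rV]_y f (a *: x + s *: y)) =
   s ^- n * \int[lebesgue_rV n]_z w z.
  rewrite /Rintegral.
  rewrite (ge0_integral_density (@gauss_rV_has_density R n)); last 2 first.
  - by apply/measurable_EFinP; exact: (measurableT_comp mf maff).
  - by move=> y; rewrite lee_fin.
  have -> : (\int[lebesgue_rV n]_y
      ((f (a *: x + s *: y)%R)%:E * (gauss_rV_pdf y)%:E) =
      \int[lebesgue_rV n]_y (EFin \o g) (a *: x + s *: y)%R)%E.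
    apply: eq_integral => y _; rewrite /g /= -EFinM; congr (_ * gauss_rV_pdf _)%:E.
    by rewrite addrAC subrr add0r scalerA mulVf ?scale1r// gt_eqF.
  have g0 z : (0 <= (EFin \o g) z)%E by rewrite lee_fin mulr_ge0// gauss_rV_pdf_ge0.
  have mgE : measurable_fun setT (EFin \o g) by exact/measurable_EFinP.
  have := ge0_integral_lebesgue_rV_affine (a *: x) s0 mgE g0.
  have -> : (\int[lebesgue_rV n]_z (EFin \o g) z =
             \int[lebesgue_rV n]_z (w z)%:E)%E.
    apply: ge0_ae_eq_integral => //.
    - exact/measurable_EFinP.
    - by move=> z _; rewrite lee_fin.
    - move: (ae_density_gauss_rV dV df); apply: filterS => z /(_ I) /= [E] _.
      rewrite /g /w E -mulrA (mulrCA (gauss_rV_pdf z)) divff ?mulr1//.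
      by rewrite gt_eqF// gauss_rV_pdf_gt0.
  move=> <-; rewrite fineZ ?exprn_gt0//.
  by rewrite mulKf// gt_eqF// exprn_gt0.
rewrite -mulrA; congr (_ * _).
rewrite /moment /Rintegral -fineZ ?expR_gt0// -ge0_integralZl//.
- congr fine; apply: eq_integral => z _; rewrite wE.
  by rewrite -EFinM /tilt; congr (_%:E); rewrite mul1r.
- by apply/measurable_EFinP; apply: measurable_funM.
- by move=> z _; rewrite lee_fin mulr_ge0// expR_ge0.
Qed.

(** * Moments of tilted measures *)

Lemma normr_coord (R : realType) n (x : 'rV[R]_n) i : `|x ord0 i| <= `|x|.
Proof.
by rewrite [leRHS]/Num.Def.normr/= mx_normrE; exact: (le_bigmax _ _ (ord0, i)).
Qed.

(** The norm of row vectors is the maximum norm. This is its dual, as in [dot_le_norm1], and it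
    splits over coordinates, as in [norm1_sqn_le]. *)
Definition norm1 {R : realType} {n} (x : 'rV[R]_n) : R := \sum_i `|x ord0 i|.

Lemma norm1_ge0 (R : realType) n (x : 'rV[R]_n) : 0 <= norm1 x.
Proof. exact: sumr_ge0. Qed.

Lemma dot_le_norm1 (R : realType) n (h z : 'rV[R]_n) :
  `|dot h z| <= `|h| * norm1 z.
Proof.
rewrite (le_trans (ler_norm_sum _ _ _))// /norm1 mulr_sumr; apply: ler_sum => i _.
by rewrite normrM ler_wpM2r// normr_coord.
Qed.

Lemma measurable_norm1 (R : realType) n :
  measurable_fun setT (norm1 : 'rV[R]_n -> R).
Proof.
by apply: measurable_sum => i; apply: measurableT_comp => //; exact: measurable_coord.
Qed.

(** A class of integrands closed under sums and products, containing polynomials and exponentials of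
    linear forms, and tame enough for [expR (- c * sqn z)] to absorb. *)
Definition exp_growth {R : realType} {n} (g : 'rV[R]_n -> R) : Prop :=
  measurable_fun setT g /\
  exists A K, [/\ 0 <= A, 0 <= K & forall z, `|g z| <= A * expR (K * norm1 z)].

Lemma exp_growthM (R : realType) n (g1 g2 : 'rV[R]_n -> R) :
  exp_growth g1 -> exp_growth g2 -> exp_growth (fun z => g1 z * g2 z).
Proof.
move=> [m1 [A1 [K1 [A10 K10 h1]]]] [m2 [A2 [K2 [A20 K20 h2]]]].
split; first exact: measurable_funM.
exists (A1 * A2), (K1 + K2); split; rewrite ?mulr_ge0 ?addr_ge0// => z.
by rewrite mulrDl expRD mulrACA normrM ler_pM.
Qed.

Lemma exp_growthD (R : realType) n (g1 g2 : 'rV[R]_n -> R) :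
  exp_growth g1 -> exp_growth g2 -> exp_growth (fun z => g1 z + g2 z).
Proof.
move=> [m1 [A1 [K1 [A10 K10 h1]]]] [m2 [A2 [K2 [A20 K20 h2]]]].
split; first exact: measurable_funD.
exists (A1 + A2), (K1 + K2); split; rewrite ?addr_ge0// => z.
have n0 := norm1_ge0 z.
rewrite (le_trans (ler_normD _ _))// mulrDl lerD//.
  apply: (le_trans (h1 z)); rewrite ler_wpM2l// ler_expR.
  by rewrite ler_wpM2r// lerDl.
apply: (le_trans (h2 z)); rewrite ler_wpM2l// ler_expR.
by rewrite ler_wpM2r// lerDr.
Qed.

Lemma exp_growth_cst (R : realType) n (k : R) :
  exp_growth (fun _ : 'rV[R]_n => k).
Proof.
split; first exact: measurable_cst.
by exists `|k|, 0; split => // z; rewrite mul0r expR0 mulr1.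
Qed.

Lemma exp_growthB (R : realType) n (g1 g2 : 'rV[R]_n -> R) :
  exp_growth g1 -> exp_growth g2 -> exp_growth (fun z => g1 z - g2 z).
Proof.
move=> h1 h2; rewrite (_ : (fun _ => _) = fun z => g1 z + (-1) * g2 z).
  by apply: exp_growthD => //; apply: exp_growthM => //; exact: exp_growth_cst.
by apply/funext => z; rewrite mulN1r.
Qed.

Lemma exp_growth_norm1 (R : realType) n : exp_growth (@norm1 R n).
Proof.
split; first exact: measurable_norm1.
exists 1, 1; split => // z; rewrite !mul1r ger0_norm ?norm1_ge0//.
by rewrite (le_trans _ (expR_ge1Dx _))// lerDr.
Qed.

Lemma exp_growth_coord (R : realType) n (i : 'I_n) :
  exp_growth (fun z : 'rV[R]_n => z ord0 i).
Proof.
split; first exact: measurable_coord.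
exists 1, 1; split => // z; rewrite !mul1r (le_trans _ (expR_ge1Dx _))//.
rewrite ler_wpDl// /norm1 (bigD1 i)//= lerDl.
exact: sumr_ge0.
Qed.

Lemma exp_growth_sum (R : realType) n (I : Type) (s : seq I)
    (g : I -> 'rV[R]_n -> R) : (forall i, exp_growth (g i)) ->
  exp_growth (fun z => \sum_(i <- s) g i z).
Proof.
move=> gg; elim: s => [|i s IH].
  by rewrite (_ : (fun _ => _) = fun=> 0) ?big_nil//; [exact: exp_growth_cst
    |apply/funext => z; rewrite big_nil].
rewrite (_ : (fun _ => _) = fun z => g i z + \sum_(j <- s) g j z).
  exact: exp_growthD.
by apply/funext => z; rewrite big_cons.
Qed.

Lemma exp_growth_dot (R : realType) n (th : 'rV[R]_n) : exp_growth (dot th).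
Proof.
apply: exp_growth_sum => i; apply: exp_growthM; first exact: exp_growth_cst.
exact: exp_growth_coord.
Qed.

Lemma exp_growth_sqn (R : realType) n : exp_growth (@sqn R n).
Proof.
by apply: exp_growth_sum => i; apply: exp_growthM; exact: exp_growth_coord.
Qed.

Lemma exp_growth_norm (R : realType) n (g : 'rV[R]_n -> R) :
  exp_growth g -> exp_growth (fun z => `|g z|).
Proof.
move=> [mg [A [K [A0 K0 h]]]]; split; first exact: measurableT_comp.
by exists A, K; split => // z; rewrite normr_id.
Qed.

Lemma exp_growth_expR_norm1 (R : realType) n :
  exp_growth (fun z : 'rV[R]_n => expR (norm1 z)).
Proof.
split; first by apply: measurableT_comp => //; exact: measurable_norm1.
by exists 1, 1; split => // z; rewrite ger0_norm ?expR_ge0// !mul1r.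
Qed.

Lemma exp_growth_expR_dot (R : realType) n (th : 'rV[R]_n) :
  exp_growth (fun z => expR (dot th z)).
Proof.
split; first by apply: measurableT_comp => //; exact: measurable_dot.
exists 1, `|th|; split => // z; rewrite ger0_norm ?expR_ge0// !mul1r.
by rewrite ler_expR (le_trans (ler_norm _))// dot_le_norm1.
Qed.

(** Each coordinate contributes at most the maximum of [K u - c u^2], reached at [u = K / (2 c)]. *)
Lemma norm1_sqn_le (R : realType) n (K c : R) (z : 'rV[R]_n) : 0 < c ->
  K * norm1 z - c * sqn z <= (K ^+ 2 / (4 * c)) *+ n.
Proof.
move=> c0; rewrite /norm1 /sqn !mulr_sumr -sumrB -[n in leRHS]card_ord -sumr_const.
apply: ler_sum => i _; rewrite ler_pdivlMr ?mulr_gt0// -subr_ge0.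
set y := z _ _.
have -> : K ^+ 2 - (K * `|y| - c * y ^+ 2) * (4 * c) = (K - 2 * c * `|y|) ^+ 2.
  by rewrite -[y ^+ 2](real_normK (num_real y)); ring.
exact: sqr_ge0.
Qed.

(** Everything follows from [1 + r <= expR r] at [r] and at [- r]. The absolute value in the
    exponent lets the bound be dominated through [dot_le_norm1]. *)
Lemma expR_taylor1 (R : realType) (r : R) :
  `|expR r - 1 - r| <= r ^+ 2 * expR `|r|.
Proof.
have h1 := expR_ge1Dx r; have h2 := expR_ge1Dx (- r).
have e0 := expR_gt0 r.
have h3 : expR r - 1 <= r * expR r.
  have := ler_wpM2r (ltW e0) h2; rewrite -expRD addNr expR0; lra.
rewrite ger0_norm; last by lra.
have [r0|r0] := leP 0 r.
  rewrite ger0_norm//.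
  have h4 : r * (expR r - 1) <= r * (r * expR r) by rewrite ler_wpM2l.
  by rewrite expr2 -mulrA; lra.
have h5 : 1 <= expR `|r| by rewrite -expR0 ler_expR.
have h6 : - r * (1 - expR r) <= - r * - r by rewrite ler_wpM2l//; lra.
have h7 : r ^+ 2 <= r ^+ 2 * expR `|r| by rewrite ler_peMr ?sqr_ge0.
have : r ^+ 2 = - r * - r by rewrite mulrNN.
lra.
Qed.

Lemma continuous_dot (R : realType) n (d : 'rV[R]_n) : continuous (dot d).
Proof.
apply: continuous_bigsum => i z.
apply: (@continuousM _ _ (cst (d ord0 i)) (fun z : 'rV[R]_n => z ord0 i)).
  exact: cst_continuous.
exact: coord_continuous.
Qed.

Lemma is_diff_quadratic (R : realType) n (f : 'rV[R]_n -> R) (x d : 'rV[R]_n)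
    (C : R) :
  (forall h, `|h| <= 1 -> `|f (x + h) - f x - dot d h| <= C * `|h| ^+ 2) ->
  is_diff x f (dot d).
Proof.
move=> fC.
have dlin : linear (dot d : 'rV[R]_n -> R).
  move=> k u v; rewrite /dot scaler_sumr -big_split/=; apply: eq_bigr => i _.
  by rewrite !mxE mulrDr mulrCA.
pose dM := GRing.isLinear.Build _ _ _ _ _ dlin.
pose D : {linear 'rV[R]_n -> R} := HB.pack (dot d : 'rV[R]_n -> R) dM.
have cD : continuous D by exact: continuous_dot.
wlog C0 : C fC / 0 < C.
  move=> /(_ (`|C| + 1)); apply; last by rewrite ltr_wpDl.
  move=> h /fC /le_trans; apply; rewrite ler_wpM2r ?exprn_ge0//.
  by rewrite (le_trans (ler_norm _))// lerDl.
have fD : (fun (U W : normedModType R) (f D : U -> W) x =>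
    f \o shift x = cst (f x) + D +o_ 0 id) 'rV[R]_n R f D x.
  apply/(@eqaddoP R 'rV[R]_n R 'rV[R]_n) => _/posnumP[e].
  have eC : 0 < e%:num / C by rewrite divr_gt0.
  near=> h.
  have h2 : `|h| <= e%:num / C by near: h; apply: (@nbhs0_le R 'rV[R]_n _ eC).
  rewrite /D/= -[(_ - _) h]/(f (h + x) - (f x + dot d h)).
  rewrite opprD addrA [h + x]addrC.
  have h1 : `|h| <= 1.
    by near: h; apply: (@nbhs0_le R 'rV[R]_n _ ltr01).
  apply: (le_trans (fC _ h1)).
  by rewrite expr2 mulrA ler_wpM2r// mulrC -ler_pdivlMr.
have dE : 'd f x = dot d :> (_ -> _) by exact: (@diff_unique _ _ _ _ D).
apply: DiffDef => //.
by apply/diff_locallyP; rewrite dE.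
Unshelve. all: by end_near. Qed.

Section moments.
Context {R : realType} {n : nat} (V : 'rV[R]_n -> R) (c : R).
Hypothesis c_gt0 : 0 < c.
Hypothesis mV : measurable_fun setT (fun z => expR (- V z)).
Hypothesis intV : (\int[lebesgue_rV n]_z (expR (- V z))%:E = 1)%E.
Implicit Types (g : 'rV[R]_n -> R) (th z : 'rV[R]_n).

Lemma tilt_gt0 th z : 0 < tilt V c th z.
Proof. exact: expR_gt0. Qed.

Lemma measurable_tilt th : measurable_fun setT (tilt V c th).
Proof.
rewrite (_ : tilt _ _ _ = fun z => expR (- V z) * expR (- c * sqn z + dot th z)).
  apply: measurable_funM => //; apply: measurableT_comp => //.
  apply: measurable_funD; last exact: measurable_dot.
  by apply: measurable_funM => //; exact: measurable_sqn.
by apply/funext => z; rewrite /tilt -expRD addrA mulNr.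
Qed.

Lemma tiltD th h z : tilt V c (th + h) z = tilt V c th z * expR (dot h z).
Proof.
by rewrite /tilt -expRD dotDl addrA.
Qed.

Lemma integrable_expN : (lebesgue_rV n).-integrable setT
  (fun z => (expR (- V z))%:E).
Proof.
apply/integrableP; split; first exact/measurable_EFinP.
under eq_integral do rewrite gee0_abs ?lee_fin ?expR_ge0//.
by rewrite intV ltry.
Qed.

(** The Gaussian factor absorbs both [g] and the linear tilt into the constant [M]; what remains is
    [expR (- V z)], integrable by [intV]. *)
Lemma integrable_tilt g th : exp_growth g ->
  (lebesgue_rV n).-integrable setT (fun z => (g z * tilt V c th z)%:E).
Proof.
move=> gg; have mg := gg.1.
have [mh [A [K [A0 K0 hK]]]] := exp_growthM gg (exp_growth_expR_dot th).
pose M := A * expR ((K ^+ 2 / (4 * c)) *+ n).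
apply: (@le_integrable _ _ _ _ _ measurableT _ (fun z => M%:E * (expR (- V z))%:E)%E).
- by apply/measurable_EFinP; apply: measurable_funM => //; exact: measurable_tilt.
- move=> z _; rewrite -EFinM lee_fin.
  have -> : tilt V c th z = expR (- V z) * expR (- (c * sqn z)) * expR (dot th z).
    by rewrite /tilt -!expRD.
  have -> : g z * (expR (- V z) * expR (- (c * sqn z)) * expR (dot th z)) =
      g z * expR (dot th z) * (expR (- (c * sqn z)) * expR (- V z)) by ring.
  have P0 : 0 <= expR (- (c * sqn z)) * expR (- V z) by rewrite mulr_ge0 ?expR_ge0.
  rewrite [leLHS]normrM (ger0_norm P0) [leRHS]ger0_norm ?mulr_ge0 ?expR_ge0//.
  rewrite (le_trans (ler_wpM2r P0 (hK z)))// mulrA ler_wpM2r ?expR_ge0//.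
  by rewrite -mulrA -expRD ler_wpM2l// ler_expR norm1_sqn_le.
- by apply: integrableZl => //; exact: integrable_expN.
Qed.

Lemma moment_ge0 g th : (forall z, 0 <= g z) -> 0 <= moment V c g th.
Proof.
by move=> g0; apply: Rintegral_ge0 => z _; rewrite mulr_ge0// ltW// tilt_gt0.
Qed.

Lemma momentD g1 g2 th : exp_growth g1 -> exp_growth g2 ->
  moment V c (fun z => g1 z + g2 z) th = moment V c g1 th + moment V c g2 th.
Proof.
move=> h1 h2; rewrite /moment -RintegralD//; try exact: integrable_tilt.
by apply: eq_Rintegral => z _; rewrite mulrDl.
Qed.

Lemma momentB g1 g2 th : exp_growth g1 -> exp_growth g2 ->
  moment V c (fun z => g1 z - g2 z) th = moment V c g1 th - moment V c g2 th.
Proof.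
move=> h1 h2; rewrite /moment -RintegralB//; try exact: integrable_tilt.
by apply: eq_Rintegral => z _; rewrite mulrBl.
Qed.

Lemma momentZ (k : R) g th : exp_growth g ->
  moment V c (fun z => k * g z) th = k * moment V c g th.
Proof.
move=> h1; rewrite /moment -RintegralZl//; last exact: integrable_tilt.
by apply: eq_Rintegral => z _; rewrite mulrA.
Qed.

Lemma moment_sum I (s : seq I) (g : I -> 'rV[R]_n -> R) th :
  (forall i, exp_growth (g i)) ->
  moment V c (fun z => \sum_(i <- s) g i z) th = \sum_(i <- s) moment V c (g i) th.
Proof.
move=> gg; elim: s => [|i s IH].
  rewrite big_nil /moment; under eq_Rintegral do rewrite big_nil mul0r.
  by rewrite Rintegral_cst// mul0r.
rewrite big_cons -IH -momentD//; last exact: exp_growth_sum.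
by apply: eq_Rintegral => z _; rewrite big_cons.
Qed.

Lemma le_moment g1 g2 th : exp_growth g1 -> exp_growth g2 ->
  (forall z, g1 z <= g2 z) -> moment V c g1 th <= moment V c g2 th.
Proof.
move=> h1 h2 h12; apply: le_Rintegral => //; try exact: integrable_tilt.
by move=> z _; rewrite ler_wpM2r// ltW// tilt_gt0.
Qed.

Lemma moment_gt0 th : 0 < moment V c (cst 1) th.
Proof.
rewrite lt_neqAle moment_ge0// andbT; apply/negP => /eqP m0.
have it := integrable_tilt th (exp_growth_cst n 1).
have I0 : (\int[lebesgue_rV n]_z `|(1 * tilt V c th z)%:E| = 0)%E.
  under eq_integral do rewrite gee0_abs ?lee_fin ?mul1r ?(ltW (tilt_gt0 _ _))//.
  move: m0; rewrite /moment /Rintegral => m0.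
  under eq_integral do rewrite -[tilt _ _ _ _]mul1r.
  by rewrite -[LHS]fineK -?m0//; exact: integrable_fin_num.
have E := (ae_eq_integral_abs _ measurableT (measurable_int _ it)).1 I0.
(* The tilt vanishes almost everywhere yet nowhere, so the whole space would be negligible, against
   the mass 1 of [expR (- V z)]. *)
suff : (\int[lebesgue_rV n]_z (expR (- V z))%:E = 0)%E.
  by rewrite intV => -[] /eqP; rewrite oner_eq0.
rewrite (ge0_ae_eq_integral _ _ (g := cst 0%E))//; first by rewrite integral0.
- exact/measurable_EFinP.
move: E; apply: filterS => z /(_ I) [] /eqP.
by rewrite mul1r gt_eqF// tilt_gt0.
Qed.

(** Differentiation under the integral, with a quantitative remainder: for [|h| <= 1], replacing
    [expR (dot h z)] by [1 + dot h z] costs at most [|h| ^+ 2 * G z], where the moment of [G] is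
    finite. *)
Lemma is_diff_moment g th : exp_growth g ->
  is_diff th (moment V c g)
    (dot (\row_i moment V c (fun z => g z * z ord0 i) th)).
Proof.
move=> gg.
pose G z := `|g z| * (norm1 z ^+ 2 * expR (norm1 z)).
have gG : exp_growth G.
  apply: exp_growthM; first exact: exp_growth_norm.
  apply: exp_growthM; last exact: exp_growth_expR_norm1.
  by apply: exp_growthM; exact: exp_growth_norm1.
apply: (@is_diff_quadratic _ _ _ _ _ (moment V c G th)) => h h1.
have gdot : exp_growth (fun z => g z * dot h z).
  by apply: exp_growthM => //; exact: exp_growth_dot.
have gexp : exp_growth (fun z => g z * expR (dot h z)).
  by apply: exp_growthM => //; exact: exp_growth_expR_dot.
have -> : dot (\row_i moment V c (fun z => g z * z ord0 i) th) h =
    moment V c (fun z => g z * dot h z) th.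
  have -> : (fun z => g z * dot h z) = (fun z => \sum_i h ord0 i * (g z * z ord0 i)).
    by apply/funext => z; rewrite /dot mulr_sumr; apply: eq_bigr => i _; rewrite mulrCA.
  have gi i : exp_growth (fun z => g z * z ord0 i).
    by apply: exp_growthM => //; exact: exp_growth_coord.
  rewrite moment_sum; last by move=> i; apply: exp_growthM => //; exact: exp_growth_cst.
  by apply: eq_bigr => i _; rewrite mxE mulrC momentZ.
have -> : moment V c g (th + h) = moment V c (fun z => g z * expR (dot h z)) th.
  by apply: eq_Rintegral => z _; rewrite tiltD mulrAC mulrA.
rewrite -!momentB//; last exact: exp_growthB.
pose r z := g z * expR (dot h z) - g z - g z * dot h z.
have gr : exp_growth r by do 2! apply: exp_growthB => //.
have hr z : `|r z| <= `|h| ^+ 2 * G z.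
  have -> : r z = g z * (expR (dot h z) - 1 - dot h z) by rewrite /r; ring.
  rewrite normrM /G mulrCA ler_wpM2l// (le_trans (expR_taylor1 _))//.
  have hz := dot_le_norm1 h z; have n0 := norm1_ge0 z.
  rewrite mulrA -exprMn -[X in X * _ <= _](real_normK (num_real _)) ler_pM//.
    by rewrite lerXn2r// nnegrE mulr_ge0.
  by rewrite ler_expR (le_trans hz)// ler_piMl.
rewrite -/r (le_trans (le_normr_Rintegral _ (integrable_tilt th gr)))//.
rewrite mulrC -momentZ//.
under eq_Rintegral do rewrite normrM [X in _ * X]ger0_norm ?(ltW (tilt_gt0 _ _))//.
apply: le_moment => //; first exact: exp_growth_norm.
by apply: exp_growthM => //; exact: exp_growth_cst.
Qed.

End moments.

(** * Integration by parts *)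

Lemma integral_lebesgue_rV_shift (R : realType) n (b : 'rV[R]_n)
    (g : 'rV[R]_n -> \bar R) : measurable_fun setT g ->
  (\int[lebesgue_rV n]_y g (b + y)%R = \int[lebesgue_rV n]_z g z)%E.
Proof.
move=> mg; have S (h : 'rV[R]_n -> \bar R) : measurable_fun setT h ->
    (forall z, 0 <= h z)%E ->
    (\int[lebesgue_rV n]_y h (b + y)%R = \int[lebesgue_rV n]_z h z)%E.
  move=> mh h0; have := ge0_integral_lebesgue_rV_affine b ltr01 mh h0.
  rewrite expr1n mul1e => <-.
  by apply: eq_integral => y _; rewrite scale1r.
rewrite [LHS]integralE [RHS]integralE; congr (_ - _)%E.
  by have <- := S _ (measurable_funepos mg) (fun z => funepos_ge0 g z);
    apply: eq_integral => z _; rewrite !funeposE.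
by have <- := S _ (measurable_funeneg mg) (fun z => funeneg_ge0 g z);
  apply: eq_integral => z _; rewrite !funenegE.
Qed.

(** The closed ball of the maximum norm in coordinates, so that measurability, finite volume and
    compactness reduce to those of an interval. *)
Definition box {R : realType} n (r : R) : set 'rV[R]_n :=
  [set z | forall i, `|z ord0 i| <= r].
Arguments box {R} n r _.

Lemma measurable_box (R : realType) n (r : R) : measurable (box n r).
Proof.
have -> : box n r = \bigcap_(i in [set: 'I_n])
    ((fun x : 'rV[R]_n => x ord0 i) @^-1` `[- r, r]).
  apply/seteqP; split => [z h i _|z h i] /=.
    by rewrite in_itv/= -ler_norml h.
  by have := h i I; rewrite /= in_itv/= -ler_norml.
apply: fin_bigcap_measurable => // i _.
by rewrite -[X in measurable X]setTI; apply: measurable_coord.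
Qed.

Lemma lebesgue_rV_box (R : realType) n (r : R) :
  (lebesgue_rV n (box n r) < +oo)%E.
Proof.
elim: n => [|n IH]; first by rewrite /= /dirac indicE ltry.
rewrite /= /prod_rV /pushforward.
have -> : (@rV_cons R n) @^-1` (box n.+1 r) = `[- r, r]%classic `*` box n r.
  apply/seteqP; split => [[u v] /= h|[u v] /= [hu hv] i].
    rewrite in_itv/= -ler_norml; split.
      have := h ord0; rewrite /rV_cons mxE; case: splitP => // j _.
      by rewrite mxE (ord1 j) eqxx mulr1n.
    move=> i; have E : rV_cons (u, v) ord0 (rshift 1 i : 'I_n.+1) = v ord0 i.
      exact: row_mxEr.
    by have := h (rshift 1 i : 'I_n.+1); rewrite E.
  rewrite /rV_cons mxE; case: fintype.split => j /=; last exact: hv.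
  by rewrite mxE (ord1 j) eqxx mulr1n; move: hu; rewrite in_itv/= -ler_norml.
rewrite product_measure1E//; last exact: measurable_box.
pose I : set R := `[- r, r]%classic.
have L : (lebesgue_measure I < +oo)%E.
  by rewrite lebesgue_measure_itv/=; case: ifP => // _; rewrite -EFinB ltry.
by rewrite lte_mul_pinfty// ge0_fin_numE.
Qed.

Lemma compact_box (R : realType) n (r : R) : compact (box n r).
Proof.
have := @rV_compact R n (fun=> `[- r, r]%classic) (fun=> @segment_compact _ _ _).
congr compact; apply/seteqP; split => z /= h i.
  by have := h i; rewrite /= in_itv/= -ler_norml.
by rewrite /= in_itv/= -ler_norml h.
Qed.

Lemma continuous_bounded_support (R : realType) n (r : R) (g : 'rV[R]_n -> R) :
  continuous g -> (forall z, ~ box n r z -> g z = 0) ->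
  exists2 C, 0 <= C & forall z, `|g z| <= C * \1_(box n r) z.
Proof.
move=> cg g0.
have : compact (g @` box n r).
  by apply: continuous_compact; [exact: continuous_subspaceT|exact: compact_box].
move=> /compact_bounded[M [Mr hM]]; exists (`|M| + 1); first by rewrite addr_ge0.
move=> z; rewrite indicE; have [zb|/negP zb] := boolP (z \in box n r).
  rewrite mulr1; apply: (hM (`|M| + 1)); last by exists z => //; rewrite inE in zb.
  by rewrite (le_lt_trans (ler_norm _))// ltrDl.
by rewrite g0 ?normr0 ?mulr0//; move=> h; apply: zb; rewrite inE.
Qed.

Lemma integrable_bounded_support (R : realType) n (r C : R) (g : 'rV[R]_n -> R) :
  measurable_fun setT g -> (forall z, `|g z| <= C * \1_(box n r) z) ->
  (lebesgue_rV n).-integrable setT (EFin \o g).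
Proof.
move=> mg gC.
apply: (@le_integrable _ _ _ _ _ measurableT _ (fun z => (C * \1_(box n r) z)%:E)).
- exact/measurable_EFinP.
- by move=> z _ /=; rewrite lee_fin (le_trans (gC z))// ler_norm.
apply/integrableP; split.
  apply/measurable_EFinP/measurable_funM => //.
  by apply: measurable_indic; exact: measurable_box.
under eq_integral do rewrite EFinM abseM.
have mb := @measurable_box R n r.
rewrite ge0_integralZl//; last first.
  by apply: measurableT_comp => //; apply/measurable_EFinP/measurable_indic.
under eq_integral do rewrite gee0_abs ?lee_fin//.
by rewrite integral_indic// setIT lte_mul_pinfty// lebesgue_rV_box.
Qed.

(* The difference quotients of [X] along [v] have integral [0] by translation
   invariance, and converge to [Y] dominatedly. *)
Lemma integral_derive_eq0 (R : realType) n (r : R) (v : 'rV[R]_n)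
    (X Y : 'rV[R]_n -> R) :
  continuous X -> continuous Y -> (forall z, is_derive z v X (Y z)) ->
  (forall z, ~ box n r z -> X z = 0) -> (forall z, ~ box n r z -> Y z = 0) ->
  (\int[lebesgue_rV n]_z (Y z)%:E = 0)%E.
Proof.
move=> cX cY dX X0 Y0.
have [CX CX0 hX] := continuous_bounded_support cX X0.
have [C C0 hY] := continuous_bounded_support cY Y0.
have mX := continuous_measurable_rV cX; have mY := continuous_measurable_rV cY.
have iX := integrable_bounded_support mX hX.
pose t k : R := k.+1%:R^-1.
have t0 k : 0 < t k by rewrite invr_gt0.
pose q k z := (t k)^-1 * (X (t k *: v + z) - X z).
have mXt k : measurable_fun setT (fun z => X (t k *: v + z)).
  have -> : (fun z => X (t k *: v + z)) = X \o (fun z => t k *: v + 1 *: z).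
    by apply/funext => z; rewrite /= scale1r.
  exact: (measurableT_comp mX (measurable_rV_affine _ _)).
have mq k : measurable_fun setT (q k).
  by apply: measurable_funM => //; exact: measurable_funB.
(* All steps [t k] are at most 1, so this one box contains the supports of all the translates. *)
pose r' := r + `|v|.
have out k z : ~ box n r' z -> ~ box n r (t k *: v + z).
  move=> zr h; apply: zr => i; have := h i; rewrite !mxE => hi.
  rewrite -[z ord0 i](addKr (t k * v ord0 i)) (le_trans (ler_normD _ _))// addrC lerD//.
  rewrite normrN normrM -[leRHS]mul1r ler_pM// ?normr_coord//.
  by rewrite gtr0_norm// invf_le1// ler1n.
have out' z : ~ box n r' z -> ~ box n r z.
  by move=> zr h; apply: zr => i; rewrite (le_trans (h i))// lerDl.
have iXt k : (lebesgue_rV n).-integrable setT (fun z => (X (t k *: v + z))%:E).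
  apply: (@integrable_bounded_support _ _ r' CX) => // z.
  rewrite indicE; have [zb|/negP zb] := boolP (z \in box n r').
    by rewrite mulr1 (le_trans (hX _))// ler_piMr// indicE; case: (_ \in _).
  by rewrite mulr0 X0 ?normr0//; apply: out => h; apply: zb; rewrite inE.
have qC k z : `|q k z| <= C * \1_(box n r') z.
  rewrite indicE; have [zb|/negP zb] := boolP (z \in box n r'); last first.
    have zb' : ~ box n r' z by move=> h; apply: zb; rewrite inE.
    by rewrite /q (X0 _ (out k z zb')) (X0 _ (out' z zb')) subrr !mulr0 normr0.
  rewrite mulr1 /q normrM normfV (gtr0_norm (t0 k)) ler_pdivrMl// mulrC.
  apply: (derive_along_le _ (t0 k) dX) => y.
  by rewrite (le_trans (hY _))// ler_piMr// indicE; case: (_ \in _).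
have iq k : (\int[lebesgue_rV n]_z (q k z)%:E = 0)%E.
  under eq_integral do rewrite EFinM EFinB.
  rewrite integralZl//; last exact: integrableB.
  rewrite integralB//.
  rewrite (@integral_lebesgue_rV_shift _ _ _ (EFin \o X))//; last exact/measurable_EFinP.
  by rewrite subee ?mule0//; exact: integrable_fin_num.
have [] := @dominated_convergence _ _ _ (lebesgue_rV n) setT measurableT
  (fun k z => (q k z)%:E) (fun z => (Y z)%:E) (fun z => (C * \1_(box n r') z)%:E).
- by move=> k; exact/measurable_EFinP.
- exact/measurable_EFinP.
- apply: aeW => z _; apply: cvg_EFin; first by apply: nearW.
  have [/cvg_ex[l dl] <-] := dX z.
  have -> : 'D_v X z = l by apply/cvg_lim.
  have /cvgr_dnbhsP := dl; apply; split => [k|]; first by rewrite gt_eqF.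
  exact: cvg_harmonic.
- have hI z : `|C * \1_(box n r') z| <= C * \1_(box n r') z :> R.
    by rewrite ger0_norm// mulr_ge0.
  apply: (integrable_bounded_support _ hI).
  by apply: measurable_funM => //; apply: measurable_indic; exact: measurable_box.
- by apply: aeW => z k _; rewrite abse_EFin lee_fin.
move=> _ _; under eq_fun do rewrite iq.
move=> /cvg_lim <-//; rewrite lim_cst//.
Qed.

(** * A Cramer-Rao bound on the trace of the covariance *)

Lemma is_derive_dot (R : realType) n (i : 'I_n) (z x : 'rV[R]_n) :
  is_derive z (delta_mx 0 i) (dot x) (x ord0 i).
Proof.
have -> : x ord0 i = \sum_j x ord0 j * (i == j)%:R.
  rewrite (bigD1 i)//= eqxx mulr1 big1 ?addr0// => j /negbTE ij.
  by rewrite eq_sym ij mulr0.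
by apply: is_derive_sumr => j; apply: is_deriveZr; exact: is_derive_coord.
Qed.

Lemma is_derive_sqn (R : realType) n (i : 'I_n) (z : 'rV[R]_n) :
  is_derive z (delta_mx 0 i) sqn (2 * z ord0 i).
Proof.
have -> : 2 * z ord0 i = \sum_j 2 * z ord0 j * (i == j)%:R.
  rewrite (bigD1 i)//= eqxx mulr1 big1 ?addr0// => j /negbTE ij.
  by rewrite eq_sym ij mulr0.
apply: is_derive_sumr => j; have D := is_derive_coord i j z.
by apply: (is_derive_eq (is_deriveMr D D)); ring.
Qed.

Section cramer_rao.
Context {R : realType} {n : nat} (V : 'rV[R]_n -> R) (c alpha : R).
Hypothesis c_gt0 : 0 < c.
Hypothesis VC2 : class_C 2 V.
Hypothesis intV : (\int[lebesgue_rV n]_z (expR (- V z))%:E = 1)%E.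
Hypothesis alpha_gt0 : 0 < alpha.
Hypothesis lapV : forall x, laplacian V x <= alpha * n%:R.
Variables (th m : 'rV[R]_n).

Let e i : 'rV[R]_n := delta_mx 0 i.
Let Vi i z := 'D_(e i) V z.
Let Vii i z := 'D_(e i) (Vi i) z.
(** The Laplacian of the potential [V + c * sqn z - dot th z] of [p] is at most [beta * n%:R]; [psi]
    below is the gradient of this potential. *)
Let beta := alpha + 2 * c.
Let p := tilt V c th.
Let psi i z := Vi i z + 2 * c * z ord0 i - th ord0 i.

Let dV i z : is_derive z (e i) V (Vi i z).
Proof. by apply: derivableP; apply: diff_derivable; exact: VC2.1. Qed.

Let dVi i z : is_derive z (e i) (Vi i) (Vii i z).
Proof. by apply: derivableP; apply: diff_derivable; exact: (VC2.2 _).1. Qed.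

Let cV : continuous V.
Proof. by move=> z; apply: differentiable_continuous; exact: VC2.1. Qed.

Let cVi i : continuous (Vi i).
Proof. by move=> z; apply: differentiable_continuous; exact: (VC2.2 _).1. Qed.

Let cVii i : continuous (Vii i).
Proof. exact: (VC2.2 _).2. Qed.

Let dp i z : is_derive z (e i) p (- psi i z * p z).
Proof.
rewrite mulrC; apply: (is_derive_comp1 (phi := expR)).
have := is_deriveDr (is_deriveBr (is_deriveNr (dV i z))
   (is_deriveZr c (is_derive_sqn i z))) (is_derive_dot i z th).
by move=> D; apply: (is_derive_eq D); rewrite /psi; ring.
Qed.

Let dpsi i z : is_derive z (e i) (psi i) (Vii i z + 2 * c).
Proof.
have D := is_derive_coord_same i z.
apply: (is_derive_eq (is_deriveBr (is_deriveDr (dVi i z)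
  (is_deriveZr (2 * c) D)) (is_derive_cst (th ord0 i) z (e i)))).
by rewrite subr0 mulr1.
Qed.

(** Total cost of the cutoff, divided by [eps]. The terms come, in order, from replacing [eta] by 1,
    from the second derivatives of [eta], and from its gradient against [z - m]. That [K] is free of
    [eps] is what allows [eps] to tend to 0. *)
Let K (z : 'rV[R]_n) : R := 3 * beta * n%:R * sqn z + 24 * sqn z +
  12 * beta * \sum_i (z ord0 i ^+ 2 + `|m ord0 i * z ord0 i|).

Let gK : exp_growth K.
Proof.
have gz i := @exp_growth_coord R n i.
apply: exp_growthD.
  by apply: exp_growthD; apply: exp_growthM;
    do ?[exact: exp_growth_cst|exact: exp_growth_sqn].
apply: exp_growthM; first exact: exp_growth_cst.
apply: exp_growth_sum => i; apply: exp_growthD; first exact: exp_growthM.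
by apply: exp_growth_norm; apply: exp_growthM => //; exact: exp_growth_cst.
Qed.

Section cutoff.
Variable eps : R.
Hypothesis eps01 : 0 < eps <= 1.

(** [eta] is a cutoff of class C^2, supported where [sqn z <= eps^-1] and increasing to 1 as [eps]
    decreases to 0; [etai] and [etaii] are its first and second derivatives. *)
Let P (z : 'rV[R]_n) : R := Num.max 0 (1 - eps * sqn z).
Let eta z : R := P z ^+ 3.
Let etai (i : 'I_n) (z : 'rV[R]_n) : R := - 6 * eps * (z ord0 i * P z ^+ 2).
Let etaii (i : 'I_n) (z : 'rV[R]_n) : R :=
  - 6 * eps * P z ^+ 2 + 24 * eps ^+ 2 * z ord0 i ^+ 2 * P z.

Let d1P i z : is_derive z (e i) (fun z => 1 - eps * sqn z) (- (2 * eps * z ord0 i)).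
Proof.
apply: (is_derive_eq (is_deriveBr (is_derive_cst (1 : R) z (e i))
  (is_deriveZr eps (is_derive_sqn i z)))).
by ring.
Qed.

Let deta i z : is_derive z (e i) eta (etai i z).
Proof.
apply: (is_derive_eq (is_derive_comp1 (d1P i z) (is_derive_maxX 1 _))).
by rewrite -/(P z) /etai; ring.
Qed.

Let detai i z : is_derive z (e i) (etai i) (etaii i z).
Proof.
have D := is_derive_comp1 (d1P i z) (is_derive_maxX 0 _).
apply: (is_derive_eq (is_deriveZr (- 6 * eps)
  (is_deriveMr (is_derive_coord_same i z) D))).
by rewrite -/(P z) /etaii; ring.
Qed.

(* Summed over [i], the divergence [Y i] of [X i] is
   [p (eta |psi - beta (z - m)|^2 - beta^2 eta |z - m|^2 + ...)]: expanding this
   square is the Cauchy-Schwarz step of the Cramer-Rao inequality, and writing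
   [eta (grad p) - p (grad eta)] in place of [- eta psi p] leaves no first order
   term in [psi] against [grad eta], so that no growth bound on [V] is needed. *)
Let X i z := eta z * (- psi i z * p z) - p z * etai i z
  + 2 * beta * (eta z * ((z ord0 i - m ord0 i) * p z)).
Let Y i z := p z * (eta z * (psi i z ^+ 2 - (Vii i z + 2 * c)) - etaii i z
  + 2 * beta * eta z + 2 * beta * (z ord0 i - m ord0 i) * etai i z
  - 2 * beta * eta z * (z ord0 i - m ord0 i) * psi i z).

Let dX i z : is_derive z (e i) (X i) (Y i z).
Proof.
have D1 := is_deriveMr (deta i z) (is_deriveMr (is_deriveNr (dpsi i z)) (dp i z)).
have D2 := is_deriveMr (dp i z) (detai i z).
have Dm := is_deriveBr (is_derive_coord_same i z) (is_derive_cst (m ord0 i) z (e i)).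
have D3 := is_deriveMr (deta i z) (is_deriveMr Dm (dp i z)).
apply: (is_derive_eq (is_deriveDr (is_deriveBr D1 D2) (is_deriveZr (2 * beta) D3))).
by rewrite /Y /cst/=; ring.
Qed.

Let cz (i : 'I_n) : continuous (fun z : 'rV[R]_n => z ord0 i).
Proof. exact: coord_continuous. Qed.

Let csqn : continuous (@sqn R n).
Proof. by apply: continuous_bigsum => i; exact: continuousXr. Qed.

Let cp : continuous p.
Proof.
apply: continuous_expr; apply: continuousDr; last exact: continuous_dot.
by apply: continuousBr; [exact: continuousNr|exact: continuousZr].
Qed.

Let cpsi i : continuous (psi i).
Proof.
apply: continuousBr; last exact: cst_continuous.
by apply: continuousDr; [exact: cVi|exact: continuousZr].
Qed.

Let cP : continuous P.
Proof.
apply: continuous_max0; apply: continuousBr; first exact: cst_continuous.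
exact: continuousZr.
Qed.

Let ceta : continuous eta.
Proof. exact: continuousXr. Qed.

Let cetai i : continuous (etai i).
Proof. by apply: continuousZr; apply: continuousMr => //; exact: continuousXr. Qed.

Let cetaii i : continuous (etaii i).
Proof.
apply: continuousDr; first by apply: continuousZr; exact: continuousXr.
by apply: continuousMr => //; apply: continuousZr; exact: continuousXr.
Qed.

Let czm i : continuous (fun z : 'rV[R]_n => z ord0 i - m ord0 i).
Proof. by apply: continuousBr => //; exact: cst_continuous. Qed.

Let cX i : continuous (X i).
Proof.
apply: continuousDr.
  apply: continuousBr; last exact: continuousMr.
  by apply: continuousMr => //; apply: continuousMr => //; exact: continuousNr.
by apply: continuousZr; apply: continuousMr => //; exact: continuousMr.
Qed.

Let cY i : continuous (Y i).
Proof.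
apply: continuousMr => //; apply: continuousBr; last first.
  apply: continuousMr => //; apply: continuousMr => //.
  exact: continuousZr.
apply: continuousDr; last first.
  by apply: continuousMr => //; exact: continuousZr.
apply: continuousDr; last exact: continuousZr.
apply: continuousBr => //; apply: continuousMr => //.
apply: continuousBr; first exact: continuousXr.
by apply: continuousDr => //; exact: cst_continuous.
Qed.

(** The support has radius [eps^-1] to the power 1/2, and [eps <= 1] bounds this by [eps^-1]. *)
Let P_box z : ~ box n eps^-1 z -> P z = 0.
Proof.
have /andP[e0 e1] := eps01.
move=> zb; apply: max_l; rewrite subr_le0 leNgt; apply/negP => ez; apply: zb => i.
have [//|zi] := leP `|z ord0 i| eps^-1.
have e'1 : 1 <= eps^-1 by rewrite invf_ge1.
have : z ord0 i ^+ 2 <= sqn z.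
  by rewrite /sqn (bigD1 i)//= lerDl sumr_ge0// => j _; exact: sqr_ge0.
rewrite -(real_normK (num_real (z ord0 i))).
have : eps^-1 * 1 <= `|z ord0 i| ^+ 2.
  by rewrite expr2 ler_pM// ?invr_ge0 ?ltW// (le_lt_trans e'1).
move=> h1 h2; have := ler_wpM2l (ltW e0) (le_trans h1 h2).
by rewrite mulr1 divff ?gt_eqF// leNgt ez.
Qed.

Let intY i : (\int[lebesgue_rV n]_z (Y i z)%:E = 0)%E.
Proof.
apply: (@integral_derive_eq0 _ _ eps^-1 (e i) (X i)) => //.
- by move=> z /P_box Pz; rewrite /X /eta /etai Pz !expr0n/=; ring.
- by move=> z /P_box Pz; rewrite /Y /eta /etai /etaii Pz !expr0n/=; ring.
Qed.

Let integrableY i : (lebesgue_rV n).-integrable setT (fun z => (Y i z)%:E).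
Proof.
have [|C _ hC] := @continuous_bounded_support _ _ eps^-1 (Y i) (@cY i).
  by move=> z /P_box Pz; rewrite /Y /eta /etai /etaii Pz !expr0n/=; ring.
by apply: integrable_bounded_support hC; exact: continuous_measurable_rV.
Qed.

(** The square in [psi] is dropped, and with it all dependence on the gradient of [V]. The right
    side integrates to 0, so the integral of the left side is nonpositive. *)
Let Y_ge z : (beta * n%:R - beta ^+ 2 * sqn (z - m) - eps * K z) * p z <=
  \sum_i Y i z.
Proof.
have /andP[e0 e1] := eps01.
have p0 : 0 < p z by exact: tilt_gt0.
have b0 : 0 < beta by rewrite addr_gt0// mulr_gt0.
have q0 : 0 <= sqn z by apply: sumr_ge0 => i _; exact: sqr_ge0.
have P0 : 0 <= P z by rewrite le_max lexx.
have P1 : P z <= 1.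
  by rewrite ge_max ler01/= gerBl mulr_ge0// ltW.
have P21 : P z ^+ 2 <= 1 by rewrite exprn_ile1.
have P20 : 0 <= P z ^+ 2 by rewrite exprn_ge0.
have eP1 : eps * P z <= 1.
  by rewrite -[leRHS]mulr1 ler_pM// ltW.
have eta0 : 0 <= eta z by rewrite exprn_ge0.
have eta1 : eta z <= 1 by rewrite exprn_ile1.
(* Bernoulli's inequality for [(1 - u)^3], truncated at 0. *)
have eta3 : 1 - 3 * (eps * sqn z) <= eta z.
  rewrite /eta /P; have u0 : 0 <= eps * sqn z by rewrite mulr_ge0// ltW.
  move: (eps * sqn z) u0 => u u0; have [h|h] := leP (1 - u) 0.
    by rewrite expr0n/=; lra.
  rewrite -subr_ge0 (_ : _ - _ = u ^+ 2 * (2 + (1 - u))); last by ring.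
  by rewrite mulr_ge0 ?sqr_ge0//; lra.
rewrite /Y -mulr_sumr mulrC ler_wpM2l ?(ltW p0)//.
(* [L i] still contains [Vii i z]: the hypothesis bounds only the sum of these terms, so it can be
   used only after summation over [i]. *)
pose L i := eta z * (2 * beta - (Vii i z + 2 * c)) - beta ^+ 2 * (z - m) ord0 i ^+ 2
   - eps * (24 * z ord0 i ^+ 2 + 12 * beta * (z ord0 i ^+ 2 + `|m ord0 i * z ord0 i|)).
apply: (@le_trans _ _ (\sum_i L i)).
  have S1 : \sum_i eta z * (2 * beta - (Vii i z + 2 * c)) =
      eta z * (2 * beta * n%:R - (laplacian V z + 2 * c * n%:R)).
    rewrite -mulr_sumr sumrB big_split/= !sumr_const card_ord.
    rewrite -[2 * beta *+ n]mulr_natr -[2 * c *+ n]mulr_natr.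
    reflexivity.
  have S3 : \sum_i eps * (24 * z ord0 i ^+ 2 +
        12 * beta * (z ord0 i ^+ 2 + `|m ord0 i * z ord0 i|)) =
      eps * (24 * sqn z + 12 * beta * \sum_i (z ord0 i ^+ 2 + `|m ord0 i * z ord0 i|)).
    by rewrite -mulr_sumr big_split/= -!mulr_sumr.
  rewrite /L !sumrB S1 S3 -mulr_sumr -/(sqn _) /K.
  set s := \sum_i _.
  have n0 : 0 <= n%:R :> R by [].
  have H1 : eta z * (beta * n%:R) <=
      eta z * (2 * beta * n%:R - (laplacian V z + 2 * c * n%:R)).
    by rewrite ler_wpM2l//; have := lapV z; rewrite /beta; lra.
  have H2 : (1 - 3 * (eps * sqn z)) * (beta * n%:R) <= eta z * (beta * n%:R).
    by rewrite ler_wpM2r// mulr_ge0// ltW.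
  lra.
apply: ler_sum => i _; rewrite /L !mxE.
set x := z ord0 i; set y := m ord0 i.
have h1 : 0 <= eta z * (psi i z - beta * (x - y)) ^+ 2 by rewrite mulr_ge0// sqr_ge0.
have h2 : eta z * (beta ^+ 2 * (x - y) ^+ 2) <= 1 * (beta ^+ 2 * (x - y) ^+ 2).
  by rewrite ler_wpM2r// mulr_ge0// sqr_ge0.
have h3 : etaii i z <= 24 * eps * x ^+ 2.
  rewrite /etaii -/x; have : 24 * eps * x ^+ 2 * (eps * P z) <= 24 * eps * x ^+ 2 * 1.
    by rewrite ler_wpM2l// mulr_ge0 ?sqr_ge0// mulr_ge0 ?(ltW e0).
  have : 0 <= 6 * eps * P z ^+ 2 by rewrite mulr_ge0// mulr_ge0 ?(ltW e0).
  lra.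
have h4 : - (2 * beta * (x - y) * etai i z) <= 12 * beta * eps * (x ^+ 2 + `|y * x|).
  have -> : - (2 * beta * (x - y) * etai i z) =
     12 * beta * eps * ((x ^+ 2 - y * x) * P z ^+ 2) by rewrite /etai -/x; ring.
  have be : 0 <= 12 * beta * eps by rewrite mulr_ge0 ?(ltW e0)// mulr_ge0 ?(ltW b0).
  rewrite ler_wpM2l//.
  apply: (@le_trans _ _ ((x ^+ 2 + `|y * x|) * P z ^+ 2)).
    by rewrite ler_wpM2r// lerD2l -[leRHS]normrN ler_norm.
  by rewrite ler_piMr// addr_ge0// sqr_ge0.
by lra.
Qed.

Let mV : measurable_fun setT (fun z => expR (- V z)).
Proof.
by apply: continuous_measurable_rV; apply: continuous_expr; exact: continuousNr.
Qed.

Let gsqm : exp_growth (fun z => sqn (z - m)).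
Proof.
apply: exp_growth_sum => i; rewrite (_ : (fun _ => _) =
  fun z : 'rV[R]_n => (z ord0 i - m ord0 i) * (z ord0 i - m ord0 i)).
  have h : exp_growth (fun z : 'rV[R]_n => z ord0 i - m ord0 i).
    by apply: exp_growthB; [exact: exp_growth_coord|exact: exp_growth_cst].
  exact: exp_growthM.
by apply/funext => z; rewrite !mxE.
Qed.

(** [Y_ge] integrated: the Cramer-Rao inequality times [beta], up to an error linear in [eps]. *)
Lemma moment_cutoff : beta * n%:R * moment V c (cst 1) th -
  beta ^+ 2 * moment V c (fun z => sqn (z - m)) th <= eps * moment V c K th.
Proof.
have gc k := exp_growth_cst n (k : R).
pose G z := beta * n%:R * (cst 1 : 'rV[R]_n -> R) z - beta ^+ 2 * sqn (z - m) - eps * K z.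
have g1 : exp_growth (fun z => beta * n%:R * (cst 1 : 'rV[R]_n -> R) z).
  exact: (exp_growthM (gc _) (gc 1)).
have g2 : exp_growth (fun z => beta ^+ 2 * sqn (z - m)).
  exact: (exp_growthM (gc _)).
have g3 : exp_growth (fun z => eps * K z) by exact: (exp_growthM (gc _)).
have gG : exp_growth G by apply: exp_growthB => //; exact: exp_growthB.
have EG : moment V c G th = beta * n%:R * moment V c (cst 1) th -
  beta ^+ 2 * moment V c (fun z => sqn (z - m)) th - eps * moment V c K th.
  rewrite /G (momentB c_gt0 mV intV th (exp_growthB g1 g2) g3).
  rewrite (momentB c_gt0 mV intV th g1 g2).
  rewrite (momentZ c_gt0 mV intV (beta * n%:R) th (gc 1)).
  rewrite (momentZ c_gt0 mV intV (beta ^+ 2) th gsqm).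
  by rewrite (momentZ c_gt0 mV intV eps th gK).
suff : moment V c G th <= 0 by rewrite EG subr_le0.
have iY : (lebesgue_rV n).-integrable setT (fun z => (\sum_i Y i z)%:E).
  under eq_fun do rewrite -sumEFin.
  by apply: integrable_sum => // i _; exact: integrableY.
have -> : 0 = \int[lebesgue_rV n]_z (\sum_i Y i z).
  rewrite /Rintegral; under eq_integral do rewrite -sumEFin.
  rewrite integral_sum//=.
  rewrite (eq_bigr (fun=> 0%E)) => [|i _]; last exact: intY.
  by rewrite big1.
apply: le_Rintegral => //; first exact: integrable_tilt.
by move=> z _; rewrite /G /= mulr1; exact: Y_ge.
Qed.

End cutoff.

(** The limit of [moment_cutoff] as [eps] tends to 0. The centre [m] is free; at the mean of [p]
    this is the lower bound on the trace of the covariance. *)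
Lemma cramer_rao : n%:R * moment V c (cst 1) th <=
  (alpha + 2 * c) * moment V c (fun z => sqn (z - m)) th.
Proof.
have b0 : 0 < beta by rewrite addr_gt0// mulr_gt0.
rewrite -(ler_pM2l b0) mulrA [leRHS]mulrA -expr2 -subr_le0 leNgt; apply/negP.
have := moment_cutoff; set k := moment _ _ (fun z => _ + _ + _) _.
rewrite -/beta; set A := _ - _ => hk A0.
(* Small enough that [eps * k] is less than the supposed positive gap [A], while still at most 1. *)
pose eps := Num.min 1 (A / (2 * (`|k| + 1))).
have k1 : 0 < 2 * (`|k| + 1) by rewrite mulr_gt0// ltr_wpDl.
have e0 : 0 < eps by rewrite lt_min ltr01 divr_gt0.
have := hk eps; rewrite e0 ge_min lexx => /(_ isT).
apply/negP; rewrite -ltNge.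
have h1 : eps * k <= eps * `|k| by rewrite ler_wpM2l ?(ltW e0)// ler_norm.
have h2 : eps * (2 * (`|k| + 1)) <= A by rewrite -ler_pdivlMr// ge_min lexx orbT.
lra.
Qed.

End cramer_rao.

(** * The drift of the heat flow *)

Section drift.
Context {R : realType} {n : nat} (V : 'rV[R]_n -> R) (c k : R).
Hypothesis c_gt0 : 0 < c.
Hypothesis mV : measurable_fun setT (fun z => expR (- V z)).
Hypothesis intV : (\int[lebesgue_rV n]_z (expR (- V z))%:E = 1)%E.
Implicit Types (g : 'rV[R]_n -> R) (x v : 'rV[R]_n).

(** The velocity field of the flow: minus the gradient of the logarithm of [e^(- c |x|^2)] times the
    Laplace transform at [k *: x]. The quotient of moments is the [i]-th mean of the tilted
    probability. *)
Definition drift x : 'rV[R]_n := \row_i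
  (2 * c * x ord0 i -
   k * (moment V c (fun z => z ord0 i) (k *: x) / moment V c (cst 1) (k *: x))).

Let is_diff_M g x : exp_growth g ->
  is_diff x (fun x => moment V c g (k *: x))
    (fun v => dot (\row_i moment V c (fun z => g z * z ord0 i) (k *: x)) (k *: v)).
Proof.
move=> gg; have D := is_diff_moment c_gt0 mV intV (k *: x) gg.
have dM := @ex_diff _ _ _ _ _ _ _ D.
have ds : differentiable ( *:%R k : 'rV[R]_n -> 'rV[R]_n) x by [].
apply: DiffDef; first exact: (differentiable_comp ds dM).
by rewrite (diff_comp ds dM) !diff_val.
Qed.

Let is_derive_M g x i : exp_growth g ->
  is_derive x (delta_mx 0 i) (fun x => moment V c g (k *: x))
    (k * moment V c (fun z => g z * z ord0 i) (k *: x)).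
Proof.
move=> gg; have D := is_diff_M x gg.
apply: DeriveDef; first exact: diff_derivable.
rewrite deriveE// diff_val /dot (bigD1 i)//= big1 => [|j /negbTE ji].
  by rewrite !mxE !eqxx mulr1 addr0 mulrC.
by rewrite !mxE ji andbF !mulr0.
Qed.

Let differentiable_M g x : exp_growth g ->
  differentiable (fun x => moment V c g (k *: x)) x.
Proof. by move=> gg; have D := is_diff_M x gg; exact: ex_diff. Qed.

Let g1 : exp_growth (cst 1 : 'rV[R]_n -> R) := exp_growth_cst n 1.

Let Mi i x := moment V c (fun z => z ord0 i) (k *: x).
Let Mii i x := moment V c (fun z => z ord0 i * z ord0 i) (k *: x).
Let M1 x := moment V c (cst 1) (k *: x).

Let M1_neq0 x : M1 x != 0.
Proof. by rewrite gt_eqF//; exact: moment_gt0. Qed.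

Lemma differentiable_drift i x : differentiable (fun x => drift x ord0 i) x.
Proof.
under eq_fun do rewrite mxE.
apply: differentiableB.
  by apply: differentiableM => //; exact: differentiable_coord.
apply: differentiableM => //; apply: differentiableM.
  exact/differentiable_M/exp_growth_coord.
exact: (differentiableV (differentiable_M x g1) (M1_neq0 x)).
Qed.

Let is_derive_M1 i x : is_derive x (delta_mx 0 i) M1 (k * Mi i x).
Proof.
have := is_derive_M x i g1; congr (is_derive _ _ _ (_ * moment _ _ _ _)).
by apply/funext => z; rewrite /= mul1r.
Qed.

(** The second derivative of a logarithmic Laplace transform is a variance; here it is that of the
    [i]-th coordinate. *)
Lemma is_derive_drift i x : is_derive x (delta_mx 0 i) (fun x => drift x ord0 i)
  (2 * c - k ^+ 2 * (Mii i x / M1 x - (Mi i x / M1 x) ^+ 2)).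
Proof.
under eq_fun do rewrite mxE.
have D1 := is_derive_M1 i x; have Di := is_derive_M x i (@exp_growth_coord R n i).
have DV := is_deriveMr Di (@is_deriveVr _ _ M1 _ _ _ (M1_neq0 x) D1).
apply: (is_derive_eq (is_deriveBr (is_deriveZr (2 * c) (is_derive_coord_same i x))
  (is_deriveZr k DV))).
rewrite -/(Mi i x) -/(Mii i x) -/(M1 x).
by field; exact: M1_neq0.
Qed.

Lemma trace_drift_le (alpha : R) x : class_C 2 V -> 0 < alpha ->
  (forall x, laplacian V x <= alpha * n%:R) ->
  \sum_i 'D_(delta_mx 0 i) (fun x => drift x ord0 i) x <=
  2 * c * n%:R - k ^+ 2 * (n%:R / (alpha + 2 * c)).
Proof.
move=> VC2 a0 lapV; have b0 : 0 < alpha + 2 * c by rewrite addr_gt0// mulr_gt0.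
have M0 : 0 < M1 x by exact: moment_gt0.
have -> : \sum_i 'D_(delta_mx 0 i) (fun x => drift x ord0 i) x =
    2 * c * n%:R - k ^+ 2 * \sum_i (Mii i x / M1 x - (Mi i x / M1 x) ^+ 2).
  under eq_bigr do rewrite (@derive_val _ _ _ _ _ _ _ (is_derive_drift _ _)).
  by rewrite sumrB sumr_const card_ord mulr_natr mulr_sumr.
rewrite lerD2l lerN2 ler_wpM2l ?sqr_ge0//.
(* The mean of the tilted probability, for which the second moment in [cramer_rao] becomes the trace
   of the covariance times [M1 x]. *)
pose m : 'rV[R]_n := \row_i (Mi i x / M1 x).
have := cramer_rao c_gt0 VC2 intV a0 lapV (k *: x) m; rewrite -/(M1 x).
have gz i := @exp_growth_coord R n i.
have gc (r : R) := exp_growth_cst n r.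
have -> : moment V c (fun z => sqn (z - m)) (k *: x) =
    \sum_i (Mii i x - 2 * m ord0 i * Mi i x + m ord0 i ^+ 2 * M1 x).
  have -> : (fun z => sqn (z - m)) = (fun z : 'rV[R]_n => \sum_i (z ord0 i * z ord0 i -
     2 * m ord0 i * z ord0 i + m ord0 i ^+ 2 * (cst 1 z))).
    apply/funext => z; apply: eq_bigr => i _; rewrite !mxE /= expr2.
    by set a := z _ _; set b := _ / _; ring.
  have h1 i : exp_growth (fun z : 'rV[R]_n => z ord0 i * z ord0 i) by exact: exp_growthM.
  have h2 i : exp_growth (fun z : 'rV[R]_n => 2 * m ord0 i * z ord0 i).
    exact: (exp_growthM (gc _)).
  have h3 i : exp_growth (fun z : 'rV[R]_n => m ord0 i ^+ 2 * cst 1 z).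
    exact: (exp_growthM (gc _) (gc 1)).
  have h12 i := exp_growthB (h1 i) (h2 i).
  rewrite (moment_sum c_gt0 mV intV); last by move=> i; exact: exp_growthD.
  apply: eq_bigr => i _; rewrite (momentD c_gt0 mV intV _ (h12 i) (h3 i)).
  rewrite (momentB c_gt0 mV intV _ (h1 i) (h2 i)).
  rewrite (momentZ c_gt0 mV intV (2 * m ord0 i) _ (gz i)).
  by rewrite (momentZ c_gt0 mV intV (m ord0 i ^+ 2) _ (gc 1)).
have -> : \sum_i (Mii i x - 2 * m ord0 i * Mi i x + m ord0 i ^+ 2 * M1 x) =
    (\sum_i (Mii i x / M1 x - (Mi i x / M1 x) ^+ 2)) * M1 x.
  rewrite mulr_suml; apply: eq_bigr => i _; rewrite !mxE.
  by field; rewrite gt_eqF.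
by rewrite mulrA ler_pM2r// => h; rewrite ler_pdivrMr// mulrC.
Qed.

Lemma gradient_ln_gaussian_moment (C : R) (u : 'rV[R]_n -> R) x : 0 < C ->
  (forall z, u z = C * expR (- (c * sqn z)) * moment V c (cst 1) (k *: z)) ->
  gradient (fun z => ln (u z)) x = - drift x.
Proof.
move=> C0 uE.
have -> : (fun z => ln (u z)) = (fun z => ln C - c * sqn z + ln (M1 z)).
  apply/funext => z; have M0 : 0 < M1 z by exact: moment_gt0.
  by rewrite uE !lnM ?posrE ?mulr_gt0 ?expR_gt0// expRK.
apply/rowP => i; rewrite !mxE.
have M0 : 0 < M1 x by exact: moment_gt0.
have D1 := is_derive_comp1 (is_derive_M1 i x) (is_derive1_ln M0).
have D2 := is_deriveZr c (is_derive_sqn i x).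
have D := is_deriveDr (is_deriveBr (is_derive_cst (ln C) x (delta_mx 0 i)) D2) D1.
rewrite (@derive_val _ _ _ _ _ _ _ D) -/(Mi i x) -/(M1 x); ring.
Qed.

End drift.

(** * The Jacobian along the heat flow *)

Lemma is_derive_time (R : realType) (U W : normedModType R) (F : R * U -> W)
    (t : R) (x : U) (d : W) : is_derive (t, x) (1, 0) F d ->
  is_derive t 1 (fun s => F (s, x)) d.
Proof.
have E (s : R) : s *: ((1, 0) : R * U) + (0, x) = (s, x).
  congr pair; first by rewrite /= addr0 [_ *: _]mulr1.
  by rewrite /= scaler0 add0r.
move=> D; have := @is_derive_along _ _ _ F (0, x) (1, 0) t d.
rewrite E => /(_ D); rewrite (_ : (fun k => _) = (fun s => F (s, x)))//.
by apply/funext => s; rewrite E.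
Qed.

Lemma derive_space (R : realType) (U W : normedModType R) (F : R * U -> W)
    (t : R) (x v : U) :
  'D_(0, v) F (t, x) = 'D_v (fun y => F (t, y)) x.
Proof.
rewrite /derive.
have -> // : (fun h : R => h^-1 *: ((F \o shift (t, x)) (h *: (0, v)) - F (t, x))) =
  (fun h : R => h^-1 *: (((fun y => F (t, y)) \o shift x) (h *: v) - F (t, x))).
apply/funext => h; congr (_ *: (F _ - _)); congr pair => /=.
by rewrite scaler0 add0r.
Qed.

Section jacobian_flow.
Context {R : realType} {n : nat} (Psi : R * 'rV[R]_n -> 'rV[R]_n).
Hypothesis Psi_smooth : smooth Psi.
Implicit Types (t : R) (x : 'rV[R]_n).

Let e (i : 'I_n) : R * 'rV[R]_n := (0, delta_mx 0 i).

(** Space derivatives are directional derivatives on the product [R * 'rV[R]_n], so that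
    [derive_swap] can exchange them with the time direction [(1, 0)]. Rows are indexed by the
    direction of differentiation. *)
Definition space_jacobian t x : 'M[R]_n :=
  \matrix_(i, j) 'D_(0, delta_mx 0 i) Psi (t, x) ord0 j.

Let dPsi p : differentiable Psi p.
Proof. exact: (Psi_smooth 1).1. Qed.

Let dDPsi v p : differentiable ('D_v Psi) p.
Proof. exact: ((Psi_smooth 2).2 v).1. Qed.

Lemma jacobian_slice t x : jacobian (fun y => Psi (t, y)) x = space_jacobian t x.
Proof.
have dP : differentiable (fun y => Psi (t, y)) x.
  exact: (@differentiable_comp _ _ _ _ (fun y => (t, y)) Psi).
apply/matrixP => i j; rewrite /jacobian /lin1_mx mxE [RHS]mxE.
by rewrite derive_space (deriveE _ dP).
Qed.

Let entry j p : R := Psi p ord0 j.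

Let dentry v j p : is_derive p v (entry j) ('D_v Psi p ord0 j).
Proof. by apply: is_derive_entry; apply: derivableP; exact: diff_derivable. Qed.

Let Dentry v j : 'D_v (entry j) = (fun p => 'D_v Psi p ord0 j).
Proof. by apply/funext => p; exact: derive_val. Qed.

Let dDentry v j p : differentiable ('D_v (entry j)) p.
Proof.
rewrite Dentry.
apply: (@differentiable_comp _ _ _ _ ('D_v Psi) (fun x : 'rV[R]_n => x ord0 j)) => //.
exact: differentiable_coord.
Qed.

Lemma continuous_space_jacobian x i j :
  continuous (fun t => space_jacobian t x i j).
Proof.
move=> t; under eq_fun do rewrite mxE.
have c1 : {for (t, x), continuous ('D_(e i) (entry j))}.
  exact/differentiable_continuous.
have c2 : {for t, continuous (fun s : R => (s, x))}.
  by apply: differentiable_continuous; apply: differentiable_pair.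
have := @continuous_comp _ _ _ (fun s : R => (s, x)) ('D_(e i) (entry j)) t c2 c1.
by rewrite Dentry.
Qed.

(** The linearised flow equation: exchange time and space derivatives, then apply the chain rule.
    The equation is assumed for all [y] because it is differentiated in space. With row vectors, [A]
    multiplies on the right. *)
Lemma is_derive_space_jacobian t x (G : 'rV[R]_n -> 'rV[R]_n) :
  (forall j y, differentiable (fun y => G y ord0 j) y) ->
  (forall y, 'D_(1, 0) Psi (t, y) = G (Psi (t, y))) ->
  let A := \matrix_(k, j) 'D_(delta_mx 0 k) (fun y => G y ord0 j) (Psi (t, x)) in
  forall i j, is_derive t 1 (fun s => space_jacobian s x i j)
    ((space_jacobian t x *m A) i j).
Proof.
move=> dG PsiG A i j.
have -> : (fun s => space_jacobian s x i j) = (fun s => 'D_(e i) (entry j) (s, x)).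
  apply/funext => s; rewrite mxE.
  exact: (congr1 (@^~ (s, x)) (esym (Dentry (e i) j))).
apply: (is_derive_time (F := 'D_(e i) (entry j))).
have -> : (space_jacobian t x *m A) i j = 'D_(1, 0) ('D_(e i) (entry j)) (t, x).
  have dv v p : derivable (entry j) p v by have [] := dentry v j p.
  rewrite -(derive_swap (dv (1, 0)) (dv (e i))
    (dDentry (1, 0) j _) (dDentry (e i) j _)).
  rewrite (Dentry (1, 0) j) derive_space.
  under eq_fun do rewrite PsiG.
  have dPt : differentiable (fun y => Psi (t, y)) x.
    exact: (@differentiable_comp _ _ _ _ (fun y => (t, y)) Psi).
  rewrite deriveE; last first.
    exact: (@differentiable_comp _ _ _ _ (fun y => Psi (t, y)) (fun y => G y ord0 j)).
  rewrite (@diff_comp _ _ _ _ (fun y => Psi (t, y)) (fun y => G y ord0 j))//=.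
  rewrite -(deriveE _ dPt) -derive_space.
  rewrite [X in 'd _ _ X]row_sum_delta linear_sum mxE; apply: eq_bigr => k _.
  by rewrite linearZ/= [space_jacobian _ _ _ _]mxE [A _ _]mxE (deriveE _ (dG j _)).
by apply: derivableP; exact: diff_derivable.
Qed.

End jacobian_flow.

(* The square of [D] is used so that the upper bound on [tau] suffices whatever
   the sign of [D]. *)
Lemma sqr_le_of_linear_ode (R : realType) (n : nat) (alpha : R) (D tau : R -> R)
    (t : R) : 0 < alpha -> continuous D -> D 0 = 1 ->
  (forall s : R, 0 < s -> is_derive s 1 D (tau s * D s)) ->
  (forall s, 0 < s -> tau s <= n%:R * (alpha - 1) * expR (- 2 * s) /
     (alpha + (1 - alpha) * expR (- 2 * s))) ->
  0 < t -> D t ^+ 2 <= (alpha + (1 - alpha) * expR (- 2 * t)) ^+ n.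
Proof.
move=> a0 cD D0 dD tauP t0.
pose Q s := alpha + (1 - alpha) * expR (- 2 * s).
have Q0 s : 0 <= s -> 0 < Q s.
  move=> s0; rewrite /Q; set E := expR _.
  have E0 : 0 < E by exact: expR_gt0.
  have E1 : E <= 1 by rewrite expR_le1 mulNr oppr_le0 mulr_ge0.
  have -> : alpha + (1 - alpha) * E = alpha * (1 - E) + E by ring.
  by rewrite ltr_wpDl// mulr_ge0 ?(ltW a0)// subr_ge0.
have dQ (s : R) : is_derive s 1 Q ((1 - alpha) * (expR (- 2 * s) * (- 2))).
  have d1 := is_deriveZr (- 2) (is_derive_id s (1 : R)).
  have d2 := is_derive_comp1 d1 (is_derive_expR _).
  apply: (is_derive_eq (is_deriveDr (is_derive_cst alpha s (1 : R))
    (is_deriveZr (1 - alpha) d2))).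
  by rewrite /=; ring.
pose g s := D s * D s * (Q s)^-1 ^+ n.
pose g' s := D s * D s * (2 * tau s * (Q s)^-1 ^+ n +
  n%:R * (Q s)^-1 ^+ n.-1 * (- (Q s) ^- 2 * ((1 - alpha) * (expR (- 2 * s) * (- 2))))).
have dg (s : R) : 0 < s -> is_derive s 1 g (g' s).
  move=> s0; have Qs := Q0 _ (ltW s0).
  have Qn0 : Q s != 0 by rewrite gt_eqF.
  have dV := is_deriveVr Qn0 (dQ s).
  have dX : is_derive (Q s)^-1 1 (fun y : R => y ^+ n) (n%:R * (Q s)^-1 ^+ n.-1).
    apply: DeriveDef; first exact: exprn_derivable.
    by rewrite exp_derive [_ *: _]mulr1.
  have dW := is_derive_comp1 dV dX.
  apply: (is_derive_eq (is_deriveMr (is_deriveMr (dD s s0) (dD s s0)) dW)).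
  by rewrite /g'; ring.
have cQ : continuous Q.
  by move=> s; apply: differentiable_continuous; exact/derivable1_diffP.
(* The equation for [D] holds only at positive times; the initial value enters through continuity at
   0, which is all the mean value theorem asks of an endpoint. *)
have cg : {within `[0, t], continuous g}.
  apply: continuous_in_subspaceT => s; rewrite inE/= in_itv/= => /andP[s0 _].
  apply: (@continuousM _ _ (fun s => D s * D s) (fun s => (Q s)^-1 ^+ n)).
    by apply: continuousMr.
  apply: (@continuous_comp _ _ _ (fun s => (Q s)^-1) (fun y => y ^+ n)).
    by apply: continuousV; [rewrite gt_eqF// Q0|exact: cQ].
  exact: exprn_continuous.
have dgt (s : R) : s \in `]0, t[%R -> is_derive s 1 g (g' s).
  by rewrite in_itv/= => /andP[s0 _]; exact: dg.
have [s] := MVT t0 dgt cg.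
rewrite in_itv/= => /andP[s0 _].
have -> : g 0 = 1.
  have Q01 : Q 0 = 1 by rewrite /Q mulr0 expR0; ring.
  by rewrite /g Q01 D0 invr1 expr1n !mulr1.
have g'0 : g' s <= 0.
  have Qs := Q0 _ (ltW s0).
  rewrite /g' -expr2 mulr_ge0_le0 ?sqr_ge0//.
  have -> : n%:R * (Q s)^-1 ^+ n.-1 * (- Q s ^- 2 * ((1 - alpha) * (expR (- 2 * s) * -2)))
    = - (2 * (n%:R * (alpha - 1) * expR (- 2 * s) / Q s)) * (Q s)^-1 ^+ n.
    have := gt_eqF Qs; move: (Q s) (expR _) => q E q0.
    (* The exponent [n.-1] is truncated at [n = 0], where both sides vanish. *)
    case: (n) => [|m]; first by rewrite !mul0r mulr0 oppr0 mul0r.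
    rewrite succnK [q^-1 ^+ m.+1]exprS; move: (q^-1 ^+ m) (m.+1%:R) => w r.
    by field; rewrite q0.
  rewrite -mulrDl mulr_le0_ge0 ?exprn_ge0 ?invr_ge0 ?(ltW Qs)//.
  by have := tauP s s0; rewrite -/(Q s); lra.
move=> gt.
have : g t <= 1 by rewrite -subr_le0 gt mulr_le0_ge0// subr0 ltW.
have Qt := Q0 _ (ltW t0).
by rewrite /g -expr2 exprVn ler_pdivrMr ?exprn_gt0// mul1r.
Qed.

(** With [b = e^(-2t)] and [r = 1 - b], the constants are [c = b / (2 r)] and [k^2 = b / r^2], and
    [alpha + 2 c] equals [Q t / r]. *)
Lemma trace_bound_eq (R : realFieldType) (alpha b r N : R) :
  0 < alpha -> 0 < r -> 0 <= b -> r = 1 - b ->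
  2 * (b / (2 * r)) * N - b * r ^- 2 * (N / (alpha + 2 * (b / (2 * r)))) =
  N * (alpha - 1) * b / (alpha + (1 - alpha) * b).
Proof.
move=> a0 r0 b0 rE.
have q0 : 0 < alpha * r + b by rewrite ltr_wpDr// mulr_gt0.
have -> : alpha + 2 * (b / (2 * r)) = (alpha * r + b) / r by field; rewrite gt_eqF.
have -> : alpha + (1 - alpha) * b = alpha * r + b by rewrite rE; ring.
have -> : N * (alpha - 1) * b = N * b * (alpha * r + b - 1) / r.
  by rewrite rE; field; rewrite -rE gt_eqF.
by field; rewrite !gt_eqF.
Qed.

(** The logarithmic derivative of the determinant is the divergence of the drift at the moving
    point. [trace_drift_le] bounds it uniformly in space, so the trajectory itself never has to be
    controlled. *)
Lemma heat_flow_det_sqr_le (R : realType) (n : nat) (V : 'rV[R]_n -> R)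
    (mu : probability 'rV[R]_n R) (alpha : R) (f : 'rV[R]_n -> R)
    (Phi : R -> 'rV[R]_n -> 'rV[R]_n) (t : R) (x : 'rV[R]_n) :
  class_C 2 V ->
  has_density (lebesgue_rV n) mu (fun x => expR (- V x)) ->
  0 < alpha -> (forall x, laplacian V x <= alpha * n%:R) ->
  has_density gauss_rV mu f -> heat_flow_solution f Phi -> 0 < t ->
  \det (jacobian (Phi t) x) ^+ 2 <=
    (alpha + (1 - alpha) * expR (- 2 * t)) ^+ n.
Proof.
move=> VC2 dV a0 lapV df [[Psi Psi_smooth PhiE] Phi0 ode] t0.
have PsiE (s : R) : 0 <= s -> (fun y => Psi (s, y)) = Phi s.
  by move=> s0; apply/funext => y; rewrite PhiE.
have [mV _ muE] := dV.
have intV : (\int[lebesgue_rV n]_z (expR (- V z))%:E = 1)%E.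
  by rewrite -muE// probability_setT.
pose A (s : R) : 'M[R]_n := \matrix_(k, j)
  'D_(delta_mx 0 k) (fun y =>
    (- gradient (fun z => ln (ornstein_uhlenbeck s f z)) y) ord0 j)
    (Psi (s, x)).
pose tau s := \tr (A s).
pose D s := \det (space_jacobian Psi s x).
have DE s : 0 <= s -> D s = \det (jacobian (Phi s) x).
  by move=> s0; rewrite -PsiE// jacobian_slice.
rewrite -DE ?(ltW t0)//.
pose a s : R := expR (- s); pose sg s : R := Num.sqrt (1 - expR (- 2 * s)).
pose c s := a s ^+ 2 / (2 * sg s ^+ 2); pose k s := a s / sg s ^+ 2.
have a2 s : expR (- 2 * s) = a s ^+ 2 by rewrite -expRM_natl mulrN mulNr.
have sg2 s : 0 < s -> sg s ^+ 2 = 1 - a s ^+ 2.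
  move=> s0; rewrite sqr_sqrtr a2// subr_ge0 -a2 ltW// expR_lt1.
  by rewrite mulNr oppr_lt0 mulr_gt0.
have sg0 s : 0 < s -> 0 < sg s.
  move=> s0; rewrite sqrtr_gt0 subr_gt0 expR_lt1.
  by rewrite mulNr oppr_lt0 mulr_gt0.
have c0 s : 0 < s -> 0 < c s.
  by move=> s0; rewrite divr_gt0 ?mulr_gt0 ?exprn_gt0 ?expR_gt0 ?sg0.
have gradE s : 0 < s ->
    gradient (fun z => ln (ornstein_uhlenbeck s f z)) =
    (fun y => - drift V (c s) (k s) y).
  move=> s0; apply/funext => y.
  apply: (gradient_ln_gaussian_moment (c0 s s0) mV intV (C := sg s ^- n)).
    by rewrite invr_gt0 exprn_gt0// sg0.
  by move=> z; exact: ornstein_uhlenbeck_moment dV df s0.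
apply: (@sqr_le_of_linear_ode _ _ _ D tau) => //.
- apply: continuous_bigsum => s; apply: continuousZr; apply: continuous_bigprod => i.
  exact: continuous_space_jacobian.
- rewrite DE// (_ : Phi 0 = id); last exact/funext.
  rewrite (_ : jacobian id x = 1%:M) ?det1//.
  apply/matrixP => i j; rewrite /jacobian /lin1_mx mxE diff_val !mxE eqxx /=.
  by rewrite eq_sym.
- move=> s s0; apply: is_derive_det => i j.
  apply: (@is_derive_space_jacobian _ _ _ Psi_smooth s x
    (fun y => - gradient (fun z => ln (ornstein_uhlenbeck s f z)) y)).
    move=> l y; rewrite gradE//.
    rewrite (_ : (fun y => _) = (fun y => drift V (c s) (k s) y ord0 l)).
      exact: (differentiable_drift (k s) (c0 s s0) mV intV).
    by apply/funext => z; rewrite opprK.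
  move=> y; have Dy : is_derive (s, y) (1, 0) Psi ('D_(1, 0) Psi (s, y)).
    by apply: derivableP; apply: diff_derivable; exact: (Psi_smooth 1).1.
  have Ds := is_derive_time Dy.
  have Do : is_derive s 1 (fun r => Psi (r, y))
      (- gradient (fun z => ln (ornstein_uhlenbeck s f z)) (Phi s y)).
    (* [Phi] and [Psi] agree at nonnegative times only; since [s > 0] they agree near [s], and the
       derivative carries over. *)
    apply: near_eq_is_derive (ode s y s0); near=> r; apply: PhiE.
    by apply: ltW; near: r; exact: lt_nbhsr.
  rewrite -PhiE ?(ltW s0)//.
  by rewrite -(@derive_val _ _ _ _ _ _ _ Do) (@derive_val _ _ _ _ _ _ _ Ds).
- move=> s s0.
  have -> : tau s = \sum_i 'D_(delta_mx 0 i)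
      (fun y => drift V (c s) (k s) y ord0 i) (Psi (s, x)).
    apply: eq_bigr => i _; rewrite mxE gradE//; congr ('D_ _ _ _).
    by apply/funext => z; rewrite opprK.
  apply: (le_trans (trace_drift_le (k s) (c0 s s0) mV intV _ VC2 a0 lapV)).
  have q := sg0 s s0; have q2 := sg2 s s0.
  rewrite le_eqVlt; apply/orP; left; apply/eqP.
  rewrite /c /k exprMn exprVn a2; apply: trace_bound_eq => //.
  - by rewrite exprn_gt0.
  - by rewrite exprn_ge0// expR_ge0.
Unshelve. all: by end_near. Qed.

Theorem theorem4p2 (R : realType) (n : nat) (V : 'rV[R]_n -> R)
    (mu : probability 'rV[R]_n R) (alpha : R) (f : 'rV[R]_n -> R)
    (Ft : R -> 'rV[R]_n -> 'rV[R]_n) (F : 'rV[R]_n -> 'rV[R]_n) :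
  class_C 2 V ->
  has_density (lebesgue_rV n) mu (fun x => expR (- V x)) ->
  0 < alpha ->
  (forall x, laplacian V x <= alpha * n%:R) ->
  has_density gauss_rV mu f ->
  unique_heat_flow_solution f Ft ->
  (forall x, Ft t x @[t --> +oo] --> F x) ->
  (forall x, differentiable F x) ->
  (forall x, \det (jacobian (Ft t) x) @[t --> +oo] --> \det (jacobian F x)) ->
  ('N[lebesgue_rV n]_+oo [(fun x => (\det (jacobian F x))%:E)]
     <= (alpha `^ (n%:R / 2))%:E)%E.
Proof.
move=> VC2 dV a0 lapV df [sol _] _ _ detF.
have det2 x : \det (jacobian F x) ^+ 2 <= alpha ^+ n.
  have cQ : (alpha + (1 - alpha) * expR (- 2 * t)) ^+ n @[t --> +oo] --> alpha ^+ n.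
    have cE : expR (- 2 * t) @[t --> +oo] --> (0 : R).
      under eq_fun do rewrite mulNr.
      apply: (cvg_comp (fun t : R => 2 * t) (fun t => expR (- t))).
        exact: gt0_cvgMry.
      exact: cvgr_expR.
    have cq : alpha + (1 - alpha) * expR (- 2 * t) @[t --> +oo] --> alpha.
      have := cvgD (cvg_cst alpha) (cvgM (cvg_cst (1 - alpha)) cE).
      by rewrite mulr0 addr0; apply.
    exact: (cvg_comp _ (fun u : R => u ^+ n) cq (@exprn_continuous _ n alpha)).
  have cD : \det (jacobian (Ft t) x) ^+ 2 @[t --> +oo] --> \det (jacobian F x) ^+ 2.
    exact: (cvg_comp _ (fun u : R => u ^+ 2) (detF x) (@exprn_continuous _ 2 _)).
  apply: (ler_cvg_to cD cQ); near=> t.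
  apply: heat_flow_det_sqr_le VC2 dV a0 lapV df sol _.
  by near: t; exact: nbhs_pinfty_gt.
(* The norm at [+oo] is the essential supremum of the absolute value when the space has positive
   measure, and 0 otherwise. *)
rewrite unlock; case: ifPn => _; last by rewrite lee_fin powR_ge0.
apply/ess_supP; apply: aeW => x /=; rewrite lee_fin.
(* Comparing squares brings the bound to [det2], with no case analysis on the sign of the
   determinant. *)
rewrite -(@ler_pXn2r _ 2)// ?nnegrE ?powR_ge0// real_normK ?num_real//.
have -> // : (alpha `^ (n%:R / 2)) ^+ 2 = alpha ^+ n.
by rewrite -powR_mulrn ?powR_ge0// -powRrM divfK// powR_mulrn// ltW.
Unshelve. all: by end_near. Qed.
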